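(* Suppose the weighted composition operators $C_{\phi_1,\omega_1}$ and $C_{\phi_2,\omega_2}$ in $L^2(\mu)$ are densely defined, and fix $\lambda\in(0,1)$. Then $\mathcal{M}_\lambda(\mathbf{C}_{\phi,\omega})=\mathbf{C}_{\phi,\omega}$ if and only if $$h_{\phi_1,\omega_1}+h_{\phi_2,\omega_2}=(h_{\phi_1,\omega_1}+h_{\phi_2,\omega_2})\circ\phi_i\quad\text{a.e. }[\mu_{\omega_i}]\quad\text{for } i=1,2.$$
   Context: $(X,\mathscr{A},\mu)$ is a $\sigma$-finite measure space and $L^2(\mu)$ is the complex Hilbert space. For an $\mathscr{A}$-measurable transformation $\phi:X\to X$ and an $\mathscr{A}$-measurable $\omega:X\to\mathbb{C}$, put $\mu_\omega(\Delta)=\int_\Delta|\omega|^2d\mu$. The weighted composition operator $C_{\phi,\omega}$ in $L^2(\mu)$ has domain $\{f\in L^2(\mu):\omega\cdot(f\circ\phi)\in L^2(\mu)\}$ and acts by $C_{\phi,\omega}f=\omega\cdot(f\circ\phi)$. It is always assumed that $\mu_\omega\circ\phi^{-1}\ll\mu$ (so $C_{\phi,\omega}$ is well-defined). $h_{\phi,\omega}:X\to[0,\infty]$ is the ($\mu$-a.e. unique) measurable function with $\mu_\omega(\phi^{-1}(\Delta))=\int_\Delta h_{\phi,\omega}\,d\mu$ for all $\Delta\in\mathscr{A}$. A pair $(T_1,T_2)$ of operators in $L^2(\mu)$ is identified with the column operator $f\mapsto\binom{T_1f}{T_2f}$ with domain $\mathcal{D}(T_1)\cap\mathcal{D}(T_2)$;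 equality of pairs means equality of these operators (including domains). When both components are densely defined, $\mathbf{C}_{\phi,\omega}=(C_{\phi_1,\omega_1},C_{\phi_2,\omega_2})$ is densely defined and closed; let $\mathbf{C}_{\phi,\omega}=\binom{U_1}{U_2}|\mathbf{C}_{\phi,\omega}|$ be its polar decomposition. The $\lambda$-spherical mean transform is $$\mathcal{M}_\lambda(\mathbf{C}_{\phi,\omega})=\big(\lambda U_1|\mathbf{C}_{\phi,\omega}|+(1-\lambda)|\mathbf{C}_{\phi,\omega}|U_1,\ \lambda U_2|\mathbf{C}_{\phi,\omega}|+(1-\lambda)|\mathbf{C}_{\phi,\omega}|U_2\big),$$ with natural domains of sums and products. *)

(* Defs.v *)
From HB Require Import structures.
From mathcomp Require Import all_boot all_order all_algebra.
From mathcomp Require Import generic_quotient ring_quotient.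
From mathcomp Require Import all_classical all_reals all_analysis.
From mathcomp Require Import measurable_realfun complex ring lra.

Set Implicit Arguments.
Unset Strict Implicit.
Unset Printing Implicit Defensive.

Import Order.TTheory GRing.Theory Num.Theory.

Local Open Scope classical_set_scope.
Local Open Scope complex_scope.
Local Open Scope ring_scope.

(* The inner product is linear in its first argument; [0 <= z] in R[i] means
   that z is real and nonnegative. *)
HB.mixin Record Lmodule_hasInner (R : realType) H of GRing.Lmodule R[i] H := {
  inner : H -> H -> R[i];
  innerDl : forall x y z, inner (x + y) z = inner x z + inner y z;
  innerZl : forall (a : R[i]) x y, inner (a *: x) y = a * inner x y;
  innerC : forall x y, inner y x = (inner x y)^*;
  inner_ge0 : forall x, 0 <= inner x x;
  inner_eq0 : forall x, inner x x = 0 -> x = 0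
}.

#[short(type=innerProductType)]
HB.structure Definition InnerProduct (R : realType) :=
  {H of GRing.Lmodule R[i] H & Lmodule_hasInner R H}.

Definition hnorm (R : realType) (H : innerProductType R) (x : H) : R :=
  Num.sqrt (complex.Re (inner x x)).

Section ProductSpace.
Context (R : realType) (H K : innerProductType R).

Definition pair_inner (x y : H * K) : R[i] := inner x.1 y.1 + inner x.2 y.2.

Let pair_innerDl x y z : pair_inner (x + y) z = pair_inner x z + pair_inner y z.
Proof. by rewrite /pair_inner /= !innerDl addrACA. Qed.

Let pair_innerZl (a : R[i]) x y : pair_inner (a *: x) y = a * pair_inner x y.
Proof. by rewrite /pair_inner /= !innerZl mulrDr. Qed.

Let pair_innerC x y : pair_inner y x = (pair_inner x y)^*.
Proof. by rewrite /pair_inner rmorphD /= -!innerC. Qed.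

Let pair_inner_ge0 x : 0 <= pair_inner x x.
Proof. by rewrite addr_ge0 ?inner_ge0. Qed.

Let pair_inner_eq0 x : pair_inner x x = 0 -> x = 0.
Proof.
case: x => x y /eqP; rewrite /pair_inner paddr_eq0 ?inner_ge0//=.
by case/andP => /eqP/inner_eq0-> /eqP/inner_eq0->.
Qed.

HB.instance Definition _ := Lmodule_hasInner.Build R (H * K)%type
  pair_innerDl pair_innerZl pair_innerC pair_inner_ge0 pair_inner_eq0.

End ProductSpace.

(* A (not necessarily everywhere defined) operator is given by its graph, so
   that equality of operators includes equality of domains. *)
Definition operator (R : realType) (H K : innerProductType R) := set (H * K).

Section Operators.
Context (R : realType).
Implicit Types H K L : innerProductType R.

Definition dom H K (T : operator H K) : set H := [set x | exists y, T (x, y)].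

Definition densely_defined H K (T : operator H K) :=
  forall (x : H) (e : R), 0 < e -> exists2 y, dom T y & hnorm (x - y) < e.

Definition graph H K (u : H -> K) : operator H K := [set p | p.2 = u p.1].

Definition op_add H K (S T : operator H K) : operator H K :=
  [set p | exists y z, [/\ S (p.1, y), T (p.1, z) & p.2 = y + z]].

Definition op_scale H K (a : R[i]) (T : operator H K) : operator H K :=
  [set p | exists2 y, T (p.1, y) & p.2 = a *: y].

Definition op_comp H K L (S : operator K L) (T : operator H K) : operator H L :=
  [set p | exists2 y, T (p.1, y) & S (y, p.2)].

Definition adjoint H K (T : operator H K) : operator K H :=
  [set p | forall x y, T (x, y) -> inner y p.1 = inner x p.2].

Definition selfadjoint H (T : operator H H) :=
  densely_defined T /\ adjoint T = T.

Definition positive_op H (T : operator H H) :=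
  forall x y, T (x, y) -> 0 <= inner y x.

Definition column H K L (S : operator H K) (T : operator H L) :
    operator H (K * L)%type :=
  [set p | S (p.1, p.2.1) /\ T (p.1, p.2.2)].

Definition is_absop H K (T : operator H K) (P : operator H H) :=
  [/\ selfadjoint P, positive_op P & op_comp P P = op_comp (adjoint T) T].

(* |T|, the positive selfadjoint square root of T*T: it exists and is unique
   when T is closed and densely defined (set0 is a dummy value otherwise). *)
Definition absop H K (T : operator H K) : operator H H :=
  xget set0 [set P | is_absop T P].

Definition partial_isometry H K (u : H -> K) :=
  [/\ linear u,
      exists M : R, forall x, hnorm (u x) <= M * hnorm x &
      forall x, (forall y, u y = 0 -> inner x y = 0) -> hnorm (u x) = hnorm x].

Definition is_polar_part H K (T : operator H K) (u : H -> K) :=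
  [/\ partial_isometry u,
      forall x, u x = 0 <-> T (x, 0) &
      T = op_comp (graph u) (absop T)].

(* The factor U of the polar decomposition T = U|T|; it exists and is unique
   when T is closed and densely defined (0 is a dummy value otherwise). *)
Definition polar_part H K (T : operator H K) : H -> K :=
  xget (fun=> 0) [set u | is_polar_part T u].

Definition spherical_mean H (l : R) (T1 T2 : operator H H) :
    operator H (H * H)%type :=
  let T := column T1 T2 in
  let P := absop T in
  let U1 := graph (fun x => (polar_part T x).1) in
  let U2 := graph (fun x => (polar_part T x).2) in
  let mean U := op_add (op_scale l%:C (op_comp U P))
                       (op_scale (1 - l)%:C (op_comp P U)) in
  column (mean U1) (mean U2).

End Operators.

Section ComplexL2.
Context d (X : measurableType d) (R : realType) (mu : {measure set X -> \bar R}).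
Implicit Types f g h : X -> R[i].

Definition measurable_funC f :=
  measurable_fun setT (fun x => complex.Re (f x)) /\
  measurable_fun setT (fun x => complex.Im (f x)).

Definition sqmod (z : R[i]) : R := complex.Re z ^+ 2 + complex.Im z ^+ 2.

Definition square_integrable f :=
  measurable_funC f /\ (\int[mu]_x (sqmod (f x))%:E < +oo)%E.

Definition iprod f g : R[i] :=
  (\int[mu]_x complex.Re (f x * (g x)^*)) +i*
  (\int[mu]_x complex.Im (f x * (g x)^*)).

Let sqmod_ge0 z : 0 <= sqmod z.
Proof. by rewrite addr_ge0 ?sqr_ge0. Qed.

Let sqmodZD a z w : sqmod (a * z + w) <= 2 * sqmod a * sqmod z + 2 * sqmod w.
Proof.
case: a z w => a b [p q] [r s]; rewrite /sqmod /=.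
have := sqr_ge0 (a * p - b * q - r); have := sqr_ge0 (a * q + b * p - s).
by rewrite !expr2; nra.
Qed.

Let measurable_sqmod f : measurable_funC f ->
  measurable_fun setT (fun x => sqmod (f x)).
Proof.
by case=> mr mi; apply: measurable_funD; apply: measurable_funX.
Qed.

Let integral_sqmodZ k f : 0 <= k -> measurable_funC f ->
  (\int[mu]_x (k%:E * (sqmod (f x))%:E) = k%:E * \int[mu]_x (sqmod (f x))%:E)%E.
Proof.
move=> k0 mf; apply: ge0_integralZl_EFin => //.
- by move=> x _; rewrite lee_fin.
- by apply/measurable_EFinP; exact: measurable_sqmod.
Qed.

Let square_integrable0 : square_integrable (fun=> 0).
Proof.
split; first by split; exact: measurable_cst.
under eq_integral do rewrite /sqmod /= expr0n /= addr0.
by rewrite integral0.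
Qed.

Let square_integrableZD (a : R[i]) f g :
  square_integrable f -> square_integrable g ->
  square_integrable (fun x => a * f x + g x).
Proof.
move=> [mf iF] [mg ig].
have mfg : measurable_funC (fun x => a * f x + g x).
  have [[mrf mif] [mrg mig]] := (mf, mg).
  split.
  - rewrite (_ : (fun x => _) = (fun x => complex.Re a * complex.Re (f x) -
      complex.Im a * complex.Im (f x) + complex.Re (g x))).
      by apply: measurable_funD => //; apply: measurable_funB;
        apply: measurable_funM.
    by apply/funext => x; case: a (f x) (g x) => ? ? [? ?] [? ?].
  - rewrite (_ : (fun x => _) = (fun x => complex.Re a * complex.Im (f x) +
      complex.Im a * complex.Re (f x) + complex.Im (g x))).
      by apply: measurable_funD => //; apply: measurable_funD;
        apply: measurable_funM.
    by apply/funext => x; case: a (f x) (g x) => ? ? [? ?] [? ?].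
split => //.
apply: (@le_lt_trans _ _ (\int[mu]_x ((2 * sqmod a)%:E * (sqmod (f x))%:E +
    2%:E * (sqmod (g x))%:E))%E).
  apply: ge0_le_integral => //=.
  - by move=> x _; rewrite lee_fin.
  - by apply/measurable_EFinP; exact: measurable_sqmod.
  - apply: emeasurable_funD; apply: emeasurable_funM => //;
      by apply/measurable_EFinP; exact: measurable_sqmod.
  - move=> x _; rewrite -!EFinM -EFinD lee_fin.
    exact: sqmodZD.
rewrite ge0_integralD//=; last 4 first.
- by move=> x _; rewrite -!EFinM lee_fin !mulr_ge0.
- by apply: emeasurable_funM => //; apply/measurable_EFinP; exact: measurable_sqmod.
- by move=> x _; rewrite -!EFinM lee_fin !mulr_ge0.
- by apply: emeasurable_funM => //; apply/measurable_EFinP; exact: measurable_sqmod.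
rewrite !integral_sqmodZ ?mulr_ge0//.
by rewrite lte_add_pinfty// lte_mul_pinfty// lee_fin mulr_ge0.
Qed.

Let integrable_sqmod f : square_integrable f ->
  mu.-integrable setT (EFin \o (fun x => sqmod (f x))).
Proof.
move=> [mf iF]; apply/integrableP; split.
  by apply/measurable_EFinP; exact: measurable_sqmod.
by under eq_integral do rewrite /= ger0_norm//.
Qed.

Let integrable_prod f g : square_integrable f -> square_integrable g ->
  mu.-integrable setT (EFin \o (fun x => complex.Re (f x * (g x)^*))) /\
  mu.-integrable setT (EFin \o (fun x => complex.Im (f x * (g x)^*))).
Proof.
move=> Lf Lg; have [[[mrf mif] _] [[mrg mig] _]] := (Lf, Lg).
have iS := integrableD measurableT (integrable_sqmod Lf) (integrable_sqmod Lg).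
split; apply: le_integrable iS => //=.
- apply/measurable_EFinP.
  rewrite (_ : (fun x => _) = (fun x => complex.Re (f x) * complex.Re (g x) +
      complex.Im (f x) * complex.Im (g x))).
    by apply: measurable_funD; apply: measurable_funM.
  by apply/funext => x; case: (f x) (g x) => ? ? [? ?] /=; rewrite mulrN opprK.
- move=> x _; rewrite lee_fin [leRHS](ger0_norm (addr_ge0 (sqmod_ge0 _) (sqmod_ge0 _))).
  case: (f x) (g x) => a b [p q]; rewrite /sqmod /= ler_norml.
  have := sqr_ge0 (a - p); have := sqr_ge0 (b - q).
  have := sqr_ge0 (a + p); have := sqr_ge0 (b + q).
  have := sqr_ge0 a; have := sqr_ge0 b; have := sqr_ge0 p; have := sqr_ge0 q.
  by rewrite !expr2 => *; apply/andP; split; nra.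
- apply/measurable_EFinP.
  rewrite (_ : (fun x => _) = (fun x => complex.Im (f x) * complex.Re (g x) -
      complex.Re (f x) * complex.Im (g x))).
    by apply: measurable_funB; apply: measurable_funM.
  by apply/funext => x; case: (f x) (g x) => ? ? [? ?] /=; rewrite mulrN addrC.
- move=> x _; rewrite lee_fin [leRHS](ger0_norm (addr_ge0 (sqmod_ge0 _) (sqmod_ge0 _))).
  case: (f x) (g x) => a b [p q]; rewrite /sqmod /= ler_norml.
  have := sqr_ge0 (a - q); have := sqr_ge0 (b - p).
  have := sqr_ge0 (a + q); have := sqr_ge0 (b + p).
  have := sqr_ge0 a; have := sqr_ge0 b; have := sqr_ge0 p; have := sqr_ge0 q.
  by rewrite !expr2 => *; apply/andP; split; nra.
Qed.

Definition L2pred : {pred X -> R[i]} := mem [set f | square_integrable f].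

Let L2pred_submod : submod_closed L2pred.
Proof.
split=> [|a f g]; first by rewrite inE; exact: square_integrable0.
by rewrite !inE => Lf Lg; exact: square_integrableZD.
Qed.

HB.instance Definition _ := GRing.isSubmodClosed.Build _ _ L2pred L2pred_submod.

Record L2fun := L2Fun { L2val :> X -> R[i]; _ : L2val \in L2pred }.
HB.instance Definition _ := [isSub for L2val].
HB.instance Definition _ := [Choice of L2fun by <:].
HB.instance Definition _ := [SubChoice_isSubLmodule of L2fun by <:].

Lemma L2funP (f : L2fun) : square_integrable f.
Proof. by have := valP f; rewrite inE. Qed.

Let L2funZE a (f : L2fun) x : (a *: f) x = a * f x.
Proof. by []. Qed.

Definition null_L2fun : {pred L2fun} := mem [set f : L2fun | {ae mu, forall x, f x = 0}].

Let null_zmod : zmod_closed null_L2fun.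
Proof.
split=> [|f g]; rewrite !inE /=; first exact: aeW.
by apply: filterS2 => x; rewrite /GRing.add /GRing.opp /= => -> ->; rewrite subrr.
Qed.

HB.instance Definition _ := GRing.isZmodClosed.Build _ null_L2fun null_zmod.

Definition L2 : Type := Quotient.quot null_L2fun.
HB.instance Definition _ := GRing.Zmodule.on L2.

Definition L2class (f : L2fun) : L2 := (\pi_(Quotient.quot null_L2fun) f)%qT.
Local Notation pi := L2class.

Lemma pi_L2P (f g : L2fun) : pi f = pi g <-> {ae mu, forall x, f x = g x}.
Proof.
have -> : (pi f = pi g) <-> (f - g \in null_L2fun).
  by rewrite Quotient.idealrBE; split => [/eqP|/eqP].
rewrite inE /=; split; apply: filterS => x;
  rewrite /GRing.add /GRing.opp /=; last by move=> ->; rewrite subrr.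
by move/eqP; rewrite subr_eq0 => /eqP.
Qed.

Definition L2repr (F : L2) : L2fun := repr (F : Quotient.quot null_L2fun).

Lemma L2reprK (F : L2) : pi (L2repr F) = F.
Proof. exact: reprK. Qed.

Lemma repr_pi (f : L2fun) : {ae mu, forall x, L2repr (pi f) x = f x}.
Proof. by apply/pi_L2P; rewrite L2reprK. Qed.

Definition L2scale (a : R[i]) (F : L2) : L2 := pi (a *: L2repr F).

Let pi_scale a (f : L2fun) : pi (a *: f) = L2scale a (pi f).
Proof.
apply/pi_L2P; apply: filterS (repr_pi f) => x.
by rewrite !L2funZE => ->.
Qed.

Let piD (f g : L2fun) : pi (f + g) = pi f + pi g.
Proof. by rewrite /L2class !piE. Qed.

Let pi0 : pi 0 = 0.
Proof. by rewrite /L2class !piE. Qed.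

Let L2scaleA a b F : L2scale a (L2scale b F) = L2scale (a * b) F.
Proof. by rewrite -[F]L2reprK -!pi_scale scalerA. Qed.
Let L2scale1 : left_id 1 L2scale.
Proof. by move=> F; rewrite -[F]L2reprK -!pi_scale scale1r. Qed.
Let L2scaleDr : right_distributive L2scale +%R.
Proof.
by move=> a F G; rewrite -[F]L2reprK -[G]L2reprK -piD -!pi_scale scalerDr piD.
Qed.
Let L2scaleDl F : {morph L2scale^~ F : a b / a + b}.
Proof. by move=> a b; rewrite -[F]L2reprK -!pi_scale scalerDl piD. Qed.

HB.instance Definition _ := GRing.Zmodule_isLmodule.Build R[i] L2
  L2scaleA L2scale1 L2scaleDr L2scaleDl.

Lemma L2reprD (F G : L2) : {ae mu, forall x, L2repr (F + G) x = L2repr F x + L2repr G x}.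
Proof.
have := repr_pi (L2repr F + L2repr G).
by rewrite piD !L2reprK.
Qed.

Lemma L2reprZ a (F : L2) : {ae mu, forall x, L2repr (a *: F) x = a * L2repr F x}.
Proof. exact: repr_pi. Qed.

Definition L2inner (F G : L2) : R[i] := iprod (L2repr F) (L2repr G).

Let ae_iprodl f f' g : square_integrable f -> square_integrable f' ->
  square_integrable g -> {ae mu, forall x, f x = f' x} ->
  iprod f g = iprod f' g.
Proof.
move=> Lf Lf' Lg ff'; have [i1 i2] := integrable_prod Lf Lg.
have [i1' i2'] := integrable_prod Lf' Lg.
congr (_ +i* _); congr fine; apply: ae_eq_integral => //.
- by case/integrableP : i1.
- by case/integrableP : i1'.
- by apply: filterS ff' => x /= ->.
- by case/integrableP : i2.
- by case/integrableP : i2'.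
- by apply: filterS ff' => x /= ->.
Qed.

Let iprodDl f g h : square_integrable f -> square_integrable g ->
  square_integrable h -> iprod (fun x => f x + g x) h = iprod f h + iprod g h.
Proof.
move=> Lf Lg Lh; have [i1 i2] := integrable_prod Lf Lh.
have [i1' i2'] := integrable_prod Lg Lh.
rewrite /iprod; simpc; congr (_ +i* _); rewrite -RintegralD//;
  by apply: eq_Rintegral => x _; rewrite mulrDl raddfD.
Qed.

Let iprodZl a f g : square_integrable f -> square_integrable g ->
  iprod (fun x => a * f x) g = a * iprod f g.
Proof.
move=> Lf Lg; have [i1 i2] := integrable_prod Lf Lg.
case: a => a b; rewrite /iprod; simpc; congr (_ +i* _).
- rewrite -!RintegralZl// -RintegralB//; last 2 first.
  + exact: (integrableZl measurableT a i1).
  + exact: (integrableZl measurableT b i2).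
  by apply: eq_Rintegral => x _; rewrite -mulrA; case: (f x * _).
- rewrite -!RintegralZl// -RintegralD//; last 2 first.
  + exact: (integrableZl measurableT a i2).
  + exact: (integrableZl measurableT b i1).
  by apply: eq_Rintegral => x _; rewrite -mulrA; case: (f x * _).
Qed.

Let L2innerDl F G H : L2inner (F + G) H = L2inner F H + L2inner G H.
Proof.
have LFG : square_integrable (fun x => L2repr F x + L2repr G x) by exact: (L2funP (L2repr F + L2repr G)).
by rewrite -iprodDl; [apply: ae_iprodl; [..|exact: L2reprD]|..]; try exact: L2funP.
Qed.

Let L2innerZl a F G : L2inner (a *: F) G = a * L2inner F G.
Proof.
have LF : square_integrable (fun x => a * L2repr F x) by exact: (L2funP (a *: L2repr F)).
by rewrite -iprodZl; [apply: ae_iprodl; [..|exact: L2reprZ]|..]; try exact: L2funP.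
Qed.

Let L2innerC F G : L2inner G F = (L2inner F G)^*.
Proof.
have [_ i2] := integrable_prod (L2funP (L2repr F)) (L2funP (L2repr G)).
rewrite /L2inner /iprod /=; congr (_ +i* _).
- apply: eq_Rintegral => x _; case: (L2repr F x) (L2repr G x) => a b [p q] /=.
  by rewrite !mulrN (mulrC p) (mulrC q).
- rewrite -mulN1r -RintegralZl//; apply: eq_Rintegral => x _.
  case: (L2repr F x) (L2repr G x) => a b [p q] /=; ring.
Qed.

Let L2inner_self F : L2inner F F = (\int[mu]_x sqmod (L2repr F x))%:C.
Proof.
rewrite /L2inner /iprod; congr (_ +i* _).
- by apply: eq_Rintegral => x _; case: (L2repr F x) => a b; rewrite /sqmod /=; ring.
- rewrite (@eq_Rintegral _ _ _ _ _ (fun=> 0)); last first.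
    by move=> x _; case: (L2repr F x) => a b /=; ring.
  by rewrite /Rintegral integral0.
Qed.

Let L2inner_ge0 F : 0 <= L2inner F F.
Proof. by rewrite L2inner_self lecR Rintegral_ge0. Qed.

Let L2inner_eq0 (F : L2) : L2inner F F = 0 -> F = 0.
Proof.
rewrite L2inner_self => -[]; rewrite /Rintegral => /eqP.
have /integrableP[mF iF] := integrable_sqmod (L2funP (L2repr F)).
rewrite fine_eq0; last first.
  exact: integrable_fin_num (integrable_sqmod (L2funP (L2repr F))).
move=> /eqP F0; have : (\int[mu]_x `|(EFin \o (fun x => sqmod (L2repr F x))) x| = 0)%E.
  by rewrite -[RHS]F0; apply: eq_integral => x _ /=; rewrite ger0_norm.
move/(ae_eq_integral_abs mu measurableT mF) => ae0.
rewrite -[F]L2reprK -pi0.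
apply/pi_L2P; apply: filterS ae0 => x /= /(_ I) [] /eqP.
rewrite paddr_eq0 ?sqr_ge0// !sqrf_eq0.
by case: (L2repr F x) => a b /= /andP[/eqP-> /eqP->].
Qed.

HB.instance Definition _ := Lmodule_hasInner.Build R L2
  L2innerDl L2innerZl L2innerC L2inner_ge0 L2inner_eq0.

End ComplexL2.

Section WeightedComposition.
Context d (X : measurableType d) (R : realType) (mu : {measure set X -> \bar R}).
Implicit Types (phi : X -> X) (w : X -> R[i]).

Definition weighted_measure w (A : set X) : \bar R :=
  (\int[mu]_(x in A) (sqmod (w x))%:E)%E.

(* The pairs (f, g) with g = w * (f \o phi) a.e.  As every element of [L2 mu]
   is square integrable, f has an image exactly when w * (f \o phi) is square
   integrable.  The choice of the representative of f is immaterial as soon as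
   [pushforward (weighted_measure w) phi `<< mu]. *)
Definition wcomp phi w : operator (L2 mu) (L2 mu) :=
  [set p | {ae mu, forall x, L2repr p.2 x = w x * L2repr p.1 (phi x)}].

Definition is_RN_density phi w (h : X -> \bar R) :=
  [/\ measurable_fun setT h,
      forall x, (0 <= h x)%E &
      forall A, measurable A ->
        pushforward (weighted_measure w) phi A = (\int[mu]_(x in A) h x)%E].

End WeightedComposition.

Arguments wcomp {d X R} mu phi w.

(* Main.v *)
Require Import Defs.
From HB Require Import structures.
From mathcomp Require Import all_boot all_order all_algebra.
From mathcomp Require Import all_classical all_reals all_analysis.
From mathcomp Require Import measurable_realfun complex ring lra.

Set Implicit Arguments.
Unset Strict Implicit.
Unset Printing Implicit Defensive.

Import Order.TTheory GRing.Theory Num.Theory.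

(** Let C be the column of the two weighted composition operators and put
    m := sqrt (h1 + h2). The change of variables
    \int |w_i|^2 (|f|^2 o phi_i) dmu = \int |f|^2 h_i dmu ([integral_wcomp])
    gives ||C f||^2 = \int m^2 |f|^2 dmu. Hence C has the domain of the
    operator M of multiplication by m, and C = U M where
    U_i f = w_i * ((f / m) o phi_i) with the convention f / 0 = 0
    ([column_polar]). Density of the domains makes h1 and h2 finite almost
    everywhere ([RN_density_finite]), so that M is selfadjoint and positive.
    As U is isometric on the range of M, polarization yields C* C = M^2
    ([is_absop_polar]); so M is a candidate for |C| and U for the polar factor.

    Both |C| and the polar factor are defined by a choice among all operators
    with the characteristic properties, so uniqueness must be proved.

    - For |C|, let P >= 0 be selfadjoint with P^2 = M^2 and let X := P - M. For
      f living on a band {a <= m <= 3a/2} one has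
      (P + a) X f = P^2 f - P M f + a X f = - X (M - a) f.
      Since P >= 0, ||(P + a) y|| >= a ||y||; since ||(M - a) f|| <= (a/2) ||f||,
      each use of this identity gains a factor 1/2, and X f = 0 in the limit
      ([selfadjoint_sqrt_agree]). Countably many bands exhaust {m > 0}; testing
      the symmetry of P against functions living on the bands and on {m = 0}
      shows P f = m f for every f in the domain of P. So P is contained in M,
      and selfadjoint operators have no proper selfadjoint extension
      ([sqrt_mulop_unique]). Neither the spectral theorem nor a limit of
      operators enters.
    - The polar factor is determined on the range of M and on ker C, and is
      bounded; the sum of these two spaces is dense because it contains every
      function living on a set {m = 0} u {1/n <= m <= n}
      ([polar_part_unique], [polar_part_column]).

    Finally, since l < 1, the l-mean of C equals C iff M U_i f = U_i M f for all
    f in the domain of M, domains included ([spherical_mean_fixed]). Both sides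
    are explicit: m * w_i * ((f / m) o phi_i) = w_i * (f o phi_i). This holds if
    m = m o phi_i where w_i <> 0, and indicators of sets of finite measure which
    exhaust X show that it forces this equality ([polar_factor_commutesP]). *)

Local Open Scope classical_set_scope.
Local Open Scope complex_scope.
Local Open Scope ring_scope.

(** * Unbounded operators on inner product spaces *)

(** The squared norm: it is directly a value of the inner product, which keeps
    square roots out of the computations. *)
Definition nsq (R : realType) (H : innerProductType R) (x : H) : R :=
  complex.Re (inner x x).

Section InnerProductTheory.
Import numFieldNormedType.Exports.
Context (R : realType).
Implicit Types H K : innerProductType R.

Lemma inner_nsq H (x : H) : inner x x = (nsq x)%:C.
Proof.
by have := ger0_Im (inner_ge0 x); rewrite /nsq; case: (inner x x) => a b /= ->.
Qed.

Lemma nsq_ge0 H (x : H) : 0 <= nsq x.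
Proof. by have := inner_ge0 x; rewrite inner_nsq ler0c. Qed.

Lemma nsq_eq0 H (x : H) : nsq x = 0 -> x = 0.
Proof. by move=> x0; apply: inner_eq0; rewrite inner_nsq x0. Qed.

Lemma hnormE H (x : H) : hnorm x = Num.sqrt (nsq x).
Proof. by []. Qed.

Lemma hnorm_ge0 H (x : H) : 0 <= hnorm x.
Proof. exact: sqrtr_ge0. Qed.

Lemma sqr_hnorm H (x : H) : hnorm x ^+ 2 = nsq x.
Proof. by rewrite hnormE sqr_sqrtr// nsq_ge0. Qed.

Lemma innerDr H (x y z : H) : inner x (y + z) = inner x y + inner x z.
Proof. by rewrite innerC innerDl rmorphD/= -!innerC. Qed.

Lemma innerZr H (a : R[i]) (x y : H) : inner x (a *: y) = a^* * inner x y.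
Proof. by rewrite innerC innerZl rmorphM/= -innerC. Qed.

Lemma conj_real_complex (a : R) : (a%:C)^* = a%:C :> R[i].
Proof. exact: conjc_real. Qed.

Lemma Re_realM (a : R) (z : R[i]) : complex.Re (a%:C * z) = a * complex.Re z.
Proof. by case: z => p q /=; rewrite mul0r subr0. Qed.

Lemma inner0l H (x : H) : inner 0 x = 0.
Proof. by rewrite -(scale0r (0 : H)) innerZl mul0r. Qed.

Lemma innerNl H (x y : H) : inner (- x) y = - inner x y.
Proof. by rewrite -scaleN1r innerZl mulN1r. Qed.

Lemma innerNr H (x y : H) : inner x (- y) = - inner x y.
Proof. by rewrite innerC innerNl rmorphN/= -innerC. Qed.

Lemma innerBr H (x y z : H) : inner x (y - z) = inner x y - inner x z.
Proof. by rewrite innerDr innerNr. Qed.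

Lemma nsqN H (x : H) : nsq (- x) = nsq x.
Proof. by rewrite /nsq innerNl innerNr opprK. Qed.

Lemma nsqD H (x y : H) :
  nsq (x + y) = nsq x + nsq y + 2 * complex.Re (inner x y).
Proof.
rewrite /nsq innerDl !innerDr (innerC x y) !raddfD/=.
by rewrite -!/(nsq _); case: (inner x y) => a b /=; ring.
Qed.

Lemma nsqB_le H (x y : H) : nsq (x - y) <= 2 * nsq x + 2 * nsq y.
Proof.
have := nsq_ge0 (x + y); rewrite !nsqD nsqN innerNr raddfN/=; lra.
Qed.

(** The inner product is a combination of squared norms of x, y, x + y and
    x + i y; so two quadratic forms that agree come from the same sesquilinear
    form. *)
Lemma polarization H K (x y : H) (x' y' : K) :
  nsq x = nsq x' -> nsq y = nsq y' -> nsq (x + y) = nsq (x' + y') ->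
  nsq (x + 'i *: y) = nsq (x' + 'i *: y') -> inner x y = inner x' y'.
Proof.
move=> ex ey; rewrite !nsqD ex ey => eD.
have nZ (G : innerProductType R) (z : G) : nsq ('i *: z) = nsq z.
  by rewrite /nsq innerZl innerZr mulrA; case: (inner z z) => a b /=; ring.
rewrite !nZ ey !innerZr.
move: eD; case: (inner x y) (inner x' y') => a b [a' b'] /= eD eI.
by congr (_ +i* _); lra.
Qed.

Definition closed_lin H K (T : operator H K) :=
  forall a x y x' y', T (x, y) -> T (x', y') -> T (a *: x + x', a *: y + y').

Definition single_valued H K (T : operator H K) :=
  forall x y y', T (x, y) -> T (x, y') -> y = y'.

(** If x is orthogonal to z then |z - x|^2 = |z|^2 + |x|^2 >= |z|^2, so no
    element of the domain comes closer to z than 0 does. *)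
Lemma dense_orth_eq0 H K (T : operator H K) (z : H) :
  densely_defined T -> (forall x, dom T x -> inner x z = 0) -> z = 0.
Proof.
move=> dT oz; apply: nsq_eq0; apply/eqP; rewrite eq_le nsq_ge0 andbT leNgt.
apply/negP => z0.
have [|y dy] := dT z (hnorm z); first by rewrite hnormE sqrtr_gt0.
apply/negP; rewrite -leNgt !hnormE ler_wsqrtr//.
rewrite nsqD nsqN innerNr innerC oz// raddf0 oppr0 mulr0 addr0 lerDl.
exact: nsq_ge0.
Qed.

Lemma adjoint_lin H K (T : operator H K) : closed_lin (adjoint T).
Proof.
move=> a x y x' y' /= Tx Tx' u v Tuv /=.
by rewrite !innerDr !innerZr (Tx _ _ Tuv) (Tx' _ _ Tuv).
Qed.

Lemma adjoint_single_valued H K (T : operator H K) :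
  densely_defined T -> single_valued (adjoint T).
Proof.
move=> dT x y y' /= Tx Tx'; apply/eqP; rewrite -subr_eq0; apply/eqP.
apply: (dense_orth_eq0 dT) => u [v Tuv].
by rewrite innerBr -(Tx _ _ Tuv) -(Tx' _ _ Tuv) subrr.
Qed.

Section Selfadjoint.
Context H (P : operator H H) (sP : selfadjoint P).

Lemma selfadjoint_lin : closed_lin P.
Proof. by have [_ <-] := sP; exact: adjoint_lin. Qed.

Lemma selfadjoint_single_valued : single_valued P.
Proof.
have [d a] := sP => x y y'; rewrite -a; exact: adjoint_single_valued.
Qed.

Lemma selfadjoint_sym x y u v : P (x, y) -> P (u, v) -> inner y u = inner x v.
Proof. by move=> Pxy; have [_ {1}<-] := sP => /(_ _ _ Pxy). Qed.

End Selfadjoint.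

(** If P is contained in Q then Q = Q* is contained in P* = P. *)
Lemma selfadjoint_maximal H (P Q : operator H H) :
  selfadjoint P -> selfadjoint Q -> P `<=` Q -> P = Q.
Proof.
move=> [_ aP] sQ PQ; apply/seteqP; split=> // -[x y] Qxy.
by rewrite -aP => u v /PQ Puv /=; exact: (selfadjoint_sym sQ Puv Qxy).
Qed.

Lemma graphE H K (u : H -> K) x y : graph u (x, y) = (y = u x).
Proof. by []. Qed.

Lemma lin_isometry_inner H K (P : operator H H) (u : H -> K) :
  closed_lin P -> linear u -> (forall x y, P (x, y) -> nsq (u y) = nsq y) ->
  forall x y x' y', P (x, y) -> P (x', y') -> inner (u y) (u y') = inner y y'.
Proof.
move=> lP lu iu x y x' y' Pxy Pxy'.
have uD a : nsq (u y + a *: u y') = nsq (y + a *: y').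
  by rewrite ![_ + a *: _]addrC -lu; apply: iu (lP a _ _ _ _ Pxy' Pxy).
apply: polarization; [exact: iu Pxy|exact: iu Pxy'| |exact: uD].
by have := uD 1; rewrite !scale1r.
Qed.

(** With T = u P and u isometric on the range of P, one has
    <T x, T y> = <P x, P y>; therefore T* T and P* P = P P are defined by the
    same condition on x. *)
Lemma is_absop_polar H K (T : operator H K) (P : operator H H) (u : H -> K) :
  selfadjoint P -> positive_op P -> linear u ->
  (forall x y, P (x, y) -> nsq (u y) = nsq y) ->
  T = op_comp (graph u) P -> is_absop T P.
Proof.
move=> sP pP lu iu TE; split=> //.
have inn := lin_isometry_inner (selfadjoint_lin sP) lu iu.
apply/seteqP; split=> -[x z] [y /= Pxy].
  move=> Pyz; exists (u y); first by rewrite TE /=; exists y.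
  rewrite TE => x' v' [y' /= Pxy']; rewrite graphE => -> /=.
  by rewrite (inn _ _ _ _ Pxy' Pxy) (selfadjoint_sym sP Pxy' Pyz).
move: Pxy; rewrite {1}TE => -[v /= Pxv]; rewrite graphE => -> aT; exists v => //=.
have [_ <-] := sP => x' y' Pxy' /=; rewrite -(inn _ _ _ _ Pxy' Pxv).
by apply: aT; rewrite TE /=; exists y'.
Qed.

(** The core of the uniqueness of positive square roots: a selfadjoint P >= 0
    whose square is N N on a subspace V where N stays a/2-close to a must equal
    N on V. With X := P - N, the identity P P = N N gives
    (P + a) X f = - X (N - a) f, and positivity of P gives
    |(P + a) y|^2 >= a^2 |y|^2, so |X f| <= |X (N - a) f| / a. As (N - a) f is in
    V and has norm at most (a/2) |f|, iterating n times leaves a factor 2^-n. *)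
Lemma selfadjoint_sqrt_agree H (P : operator H H) (a : R) (V : set H)
    (N : H -> H) :
  selfadjoint P -> positive_op P -> linear N -> 0 < a ->
  (forall f, V f -> V (N f)) -> (forall f, V f -> V (N f - a%:C *: f)) ->
  (forall f, V f -> op_comp P P (f, N (N f))) ->
  (forall f, V f -> inner f (N (N f)) = inner (N f) (N f)) ->
  (forall f, V f -> nsq (N f - a%:C *: f) <= (a / 2) ^+ 2 * nsq f) ->
  forall f, V f -> P (f, N f).
Proof.
move=> sP pP lN a0 VN VNa PP symN closeN.
have nZ (x : H) : nsq (a%:C *: x) = a ^+ 2 * nsq x.
  by rewrite /nsq innerZl innerZr; case: (inner x x) => p q /=; ring.
(* 10 a^2 bounds |P f - N f|^2 / |f|^2 crudely: |P f| = |N f| and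
   |N f|^2 <= 2 (a/2)^2 |f|^2 + 2 a^2 |f|^2. *)
have bound n f p : V f -> P (f, p) ->
    nsq (p - N f) <= 4^-1 ^+ n * (10 * a ^+ 2 * nsq f).
  elim: n f p => [|n IH] f p Vf Pfp.
    have [p' /= Pp Pp'] := PP _ Vf.
    have ep := selfadjoint_single_valued sP Pp Pfp; rewrite ep in Pp'.
    have np : nsq p = nsq (N f).
      by rewrite /nsq (selfadjoint_sym sP Pfp Pp') symN.
    have := nsqB_le p (N f); have := nsqB_le (N f - a%:C *: f) (- (a%:C *: f)).
    rewrite opprK subrK nsqN nZ expr0 np; have := closeN _ Vf.
    rewrite expr2; lra.
  set g := N f - a%:C *: f.
  have [p1 /= Pp1 Pp1'] := PP _ Vf.
  have ep := selfadjoint_single_valued sP Pp1 Pfp; rewrite ep in Pp1'.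
  have [q /= Pq _] := PP _ (VN _ Vf).
  have lin := selfadjoint_lin sP.
  have PX : P (p - N f, N (N f) - q).
    by have := lin (-1) _ _ _ _ Pq Pp1'; rewrite !scaleN1r ![- _ + _]addrC.
  have Pg : P (g, q - a%:C *: p).
    by have := lin (- a%:C) _ _ _ _ Pfp Pq; rewrite !scaleNr ![- _ + _]addrC.
  have XE : (N (N f) - q) + a%:C *: (p - N f) = - ((q - a%:C *: p) - N g).
    have -> : N g = N (N f) - a%:C *: N f by rewrite /g -scaleNr addrC lN addrC scaleNr.
    rewrite scalerBr opprB [- (q - _)]opprB addrACA [RHS]addrACA.
    by rewrite [- q - _]addrC.
  have /= := IH g _ (VNa _ Vf) Pg.
  rewrite -[nsq (q - _ - _)]nsqN -XE (nsqD (N (N f) - q)) nZ innerZr conj_real_complex Re_realM.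
  have := pP _ _ PX; have := nsq_ge0 (N (N f) - q).
  have := closeN _ Vf; rewrite -/g.
  rewrite lecE /= => h1 h2 /andP[_ h3].
  rewrite [4^-1 ^+ n.+1]exprS.
  set c := 4^-1 ^+ n; have c0 : 0 <= c by rewrite exprn_ge0.
  move=> h4.
  have h5 : c * (10 * a ^+ 2 * nsq g) <= c * (10 * a ^+ 2 * ((a / 2) ^+ 2 * nsq f)).
    by rewrite ler_wpM2l// ler_wpM2l// mulr_ge0// sqr_ge0.
  have a2 : 0 < a ^+ 2 by rewrite exprn_gt0.
  rewrite -(ler_pM2l a2).
  have h6 : 0 <= a * complex.Re (inner (N (N f) - q) (p - N f)).
    by rewrite mulr_ge0// ltW.
  apply: (@le_trans _ _ (c * (10 * a ^+ 2 * ((a / 2) ^+ 2 * nsq f)))).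
    apply: le_trans h5; apply: le_trans h4.
    lra.
  by rewrite le_eqVlt; apply/orP; left; apply/eqP; field.
move=> f Vf; have [p /= Pfp _] := PP _ Vf.
suff -> : N f = p by [].
apply/esym/eqP; rewrite -subr_eq0; apply/eqP/nsq_eq0/eqP.
rewrite eq_le nsq_ge0 andbT.
have cv : (fun n => 4^-1 ^+ n * (10 * a ^+ 2 * nsq f) : R) @ \oo --> (0 : R).
  rewrite -[X in _ --> X](mul0r (10 * a ^+ 2 * nsq f)).
  apply: cvgM; last exact: cvg_cst.
  by apply: cvg_expr; rewrite ger0_norm// invf_lt1// ltr1n.
have lim0 := cvg_lim (@norm_hausdorff _ R) cv.
rewrite -[leRHS]lim0.
apply: limr_ge; first by apply/cvg_ex; exists 0.
by near=> n; exact: bound.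
Unshelve. all: by end_near. Qed.


(** A polar factor is forced on the range of |T| by T = u |T|, vanishes on the
    kernel of T, and is continuous. *)
Lemma polar_part_unique H K (T : operator H K) (u v : H -> K) :
  is_polar_part T u -> is_polar_part T v -> single_valued (absop T) ->
  (forall x e, 0 < e -> exists z y k,
    [/\ absop T (z, y), T (k, 0) & nsq (x - (y + k)) < e]) ->
  u = v.
Proof.
move=> [[lu [A bA] _] ku Tu] [[lv [B bB] _] kv Tv] svP dense.
have bnd (f : H -> K) C : (forall x, hnorm (f x) <= C * hnorm x) ->
    forall x, nsq (f x) <= C ^+ 2 * nsq x.
  move=> fC x; rewrite -!sqr_hnorm -exprMn.
  by rewrite ler_pXn2r ?nnegrE ?hnorm_ge0// (le_trans (hnorm_ge0 _) (fC x)).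
have linD (f : H -> K) : linear f -> forall x y, f (x + y) = f x + f y.
  by move=> lf x y; rewrite -[x]scale1r lf !scale1r.
have uv_ran z y : absop T (z, y) -> u y = v y.
  move=> Pzy; have : T (z, u y) by rewrite Tu; exists y.
  by rewrite Tv => -[y' /= Pzy']; rewrite graphE (svP _ _ _ Pzy' Pzy).
apply/funext => x; apply: subr0_eq; apply: nsq_eq0; apply/eqP.
rewrite eq_le nsq_ge0 andbT leNgt; apply/negP => N0.
set C := 2 * (A ^+ 2 + B ^+ 2) + 1.
have C0 : 0 < C by rewrite /C; have := sqr_ge0 A; have := sqr_ge0 B; lra.
have [z [y [k [Pzy Tk]]]] := dense x _ (divr_gt0 N0 C0).
set q := x - (y + k); rewrite ltr_pdivlMr// mulrC => small.
have uvq : u x - v x = u q - v q.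
  have xE : x = q + (y + k) by rewrite subrK.
  rewrite [in LHS]xE; move: q {xE} small => q _.
  rewrite !(linD u lu) !(linD v lv) (uv_ran _ _ Pzy).
  rewrite ((ku k).2 Tk) ((kv k).2 Tk) addr0.
  by rewrite opprD addrACA subrr addr0.
move: small; apply/negP; rewrite -leNgt uvq.
apply: le_trans (nsqB_le _ _) _.
have := bnd _ _ bA q; have := bnd _ _ bB q; have := nsq_ge0 q.
rewrite /C; lra.
Qed.

(** On the domain of P the first summand of the mean is l S_i, so the mean is S_i
    exactly when (1 - l) P u_i is defined there and equals (1 - l) S_i. *)
Lemma spherical_mean_fixed H (l : R) (S1 S2 : operator H H) :
  let P := absop (column S1 S2) in let u := polar_part (column S1 S2) in
  l < 1 -> single_valued P -> column S1 S2 = op_comp (graph u) P ->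
  spherical_mean l S1 S2 = column S1 S2 <->
  (forall x y, P (x, y) -> P ((u x).1, (u y).1) /\ P ((u x).2, (u y).2)).
Proof.
move=> P u l1 svP TE.
have l1C : (1 - l)%:C != 0 :> R[i] by rewrite eq_complex /= subr_eq0 gt_eqF.
have canc (v y : H) : v = l%:C *: v + (1 - l)%:C *: y -> v = y.
  move=> /eqP; rewrite addrC -subr_eq -{1}(scale1r v) -scalerBl.
  rewrite -[1 in X in X -> _](_ : 1%:C = 1)// -raddfB => /eqP.
  exact: scalerI.
have join (v : H) : v = l%:C *: v + (1 - l)%:C *: v.
  by rewrite -scalerDl -raddfD /= addrC subrK scale1r.
split=> [E x y Pxy|E].
  have : column S1 S2 (x, u y) by rewrite TE; exists y.
  rewrite -E /spherical_mean -/P -/u.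
  case; rewrite /op_add /op_scale /op_comp /graph /=.
  move=> [_ [_ [[_ [y1 Py1 ->] ->] [z1 [_ -> Pz1] ->] e1]]].
  move=> [_ [_ [[_ [y2 Py2 ->] ->] [z2 [_ -> Pz2] ->] e2]]].
  rewrite (svP _ _ _ Py1 Pxy) in e1; rewrite (svP _ _ _ Py2 Pxy) in e2.
  by rewrite (canc _ _ e1) (canc _ _ e2).
apply/seteqP; split=> -[x [v1 v2]].
  rewrite /spherical_mean -/P -/u.
  case; rewrite /op_add /op_scale /op_comp /graph /=.
  move=> [_ [_ [[_ [y1 Py1 ->] ->] [z1 [_ -> Pz1] ->] ->]]].
  move=> [_ [_ [[_ [y2 Py2 ->] ->] [z2 [_ -> Pz2] ->] ->]]].
  have [Q1 Q2] := E _ _ Py1; rewrite (svP _ _ _ Py2 Py1).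
  rewrite (svP _ _ _ Pz1 Q1) (svP _ _ _ Pz2 Q2) -!join TE.
  by exists y1 => //; rewrite graphE -surjective_pairing.
rewrite TE => -[y /= Pxy]; rewrite graphE => uy.
have [Q1 Q2] := E _ _ Pxy.
have [-> ->] : v1 = (u y).1 /\ v2 = (u y).2 by rewrite -uy.
rewrite /spherical_mean -/P -/u; split;
  rewrite /op_add /op_scale /op_comp /graph /=.
- exists (l%:C *: (u y).1), ((1 - l)%:C *: (u y).1); split => //.
  + by exists (u y).1 => //; exists y.
  + by exists (u y).1 => //; exists (u x).1.
- exists (l%:C *: (u y).2), ((1 - l)%:C *: (u y).2); split => //.
  + by exists (u y).2 => //; exists y.
  + by exists (u y).2 => //; exists (u x).2.
Qed.
End InnerProductTheory.


(** * Change of variables for densities *)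

Section Density.
Context d (X : measurableType d) (R : realType) (mu : {measure set X -> \bar R}).
Import HBNNSimple.
Local Open Scope ereal_scope.

Section Approx.
Context (psi : X -> X) (k : X -> \bar R).
Hypotheses (mpsi : measurable_fun setT psi) (mk : measurable_fun setT k).
Hypothesis k0 : forall x, 0 <= k x.

Lemma integral_nnsfun_comp_mul (s : {nnsfun X >-> R}) :
  \int[mu]_x ((s (psi x))%:E * k x) =
  \sum_(y \in range s) y%:E * \int[mu]_(x in psi @^-1` (s @^-1` [set y])) k x.
Proof.
have mS y : measurable (psi @^-1` (s @^-1` [set y])).
  by rewrite -[X in measurable X]setTI; apply: mpsi.
transitivity (\int[mu]_x \sum_(y \in range s)
    (y%:E * (k \_ (psi @^-1` (s @^-1` [set y]))) x)).
  apply: eq_integral => x _; rewrite [in LHS]fimfunE -fsumEFin//.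
  rewrite ge0_mule_fsuml => [|y]; last exact: nnfun_muleindic_ge0.
  apply: eq_fsbigr => y _; rewrite EFinM -muleA; congr (_ * _).
  by rewrite muleC epatch_indic.
have mkS y : measurable_fun setT (k \_ (psi @^-1` (s @^-1` [set y]))).
  by apply/(measurable_restrictT _ _).1 => //; exact: measurable_funTS.
have kS0 y x : 0 <= (k \_ (psi @^-1` (s @^-1` [set y]))) x.
  by apply: erestrict_ge0 => *; exact: k0.
have ykS0 y x : 0 <= y%:E * (k \_ (psi @^-1` (s @^-1` [set y]))) x.
  have [y0|y0] := leP 0%R y; first by rewrite mule_ge0.
  rewrite patchE; case: ifPn; last by rewrite mule0.
  by rewrite inE/= => sy; move: y0; rewrite -sy ltNge fun_ge0.
rewrite ge0_integral_fsum//; last first.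
  by move=> y; apply: emeasurable_funM.
apply: eq_fsbigr => y; rewrite inE => -[x _ <-].
by rewrite ge0_integralZl// ?lee_fin ?fun_ge0// -integral_mkcond.
Qed.

Context (F : X -> R) (mF : measurable_fun setT F) (F0 : forall x, (0 <= F x)%R).

(** The weight k may take the value +oo; the product of the limits is still the
    limit of the products since F is finite and the approximations of F vanish
    wherever F does. *)
Lemma integral_comp_mul_approx :
  let mE : measurable_fun setT (EFin \o F) := (measurable_EFinP _ _).2 mF in
  \int[mu]_x ((F (psi x))%:E * k x) =
  limn (fun n => \int[mu]_x ((nnsfun_approx measurableT mE n (psi x))%:E * k x)).
Proof.
move=> mE; set s := nnsfun_approx measurableT mE.
have sE y : (s n y)%:E @[n --> \oo] --> (F y)%:E.
  by apply: (@cvg_nnsfun_approx _ _ _ _ measurableT _ mE) => // x _; rewrite lee_fin.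
have nds y m n : (m <= n)%N -> (s m y <= s n y)%R.
  by move=> mn; have /lefP := nd_nnsfun_approx measurableT mE mn.
have sF n y : (s n y <= F y)%R.
  rewrite -lee_fin -(cvg_lim (@ereal_hausdorff R) (sE y)).
  apply: lime_ge; first by apply/cvg_ex; exists (F y)%:E.
  by near=> m; rewrite lee_fin; apply: nds; near: m; exact: nbhs_infty_ge.
rewrite -monotone_convergence//=; last first.
- by move=> x _ m n mn; rewrite lee_wpmul2r// lee_fin nds.
- by move=> n x _; rewrite mule_ge0// lee_fin fun_ge0.
- move=> n; apply: emeasurable_funM => //; apply/measurable_EFinP.
  exact: (measurableT_comp (f := s n)).
apply: eq_integral => x _; apply/esym/cvg_lim => //.
have [F00|Fn0] := eqVneq (F (psi x)) 0%R.
  rewrite F00 mul0e; apply: cvg_near_cst; near=> n.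
  have -> : s n (psi x) = 0%R.
    by apply/eqP; rewrite eq_le fun_ge0 andbT -F00 sF.
  by rewrite mul0e.
apply: cvgeM => //; last exact: cvg_cst.
have [kf|kf] := boolP (k x \is a fin_num); first exact: mule_def_fin.
by apply: mule_def_neq0_infty => //; rewrite eqe.
Unshelve. all: by end_near. Qed.

End Approx.

(** If the measure with density g is transported by phi to the measure with
    density h, this also holds for integrals of functions: both integrals are
    limits along the same simple functions, where it is the hypothesis on the
    level sets. *)
Lemma integral_comp_density (phi : X -> X) (g h : X -> \bar R) (F : X -> R) :
  measurable_fun setT phi ->
  measurable_fun setT g -> (forall x, 0 <= g x) ->
  measurable_fun setT h -> (forall x, 0 <= h x) ->
  (forall A, measurable A -> \int[mu]_(x in phi @^-1` A) g x =
    \int[mu]_(x in A) h x) ->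
  measurable_fun setT F -> (forall x, (0 <= F x)%R) ->
  \int[mu]_x ((F (phi x))%:E * g x) = \int[mu]_x ((F x)%:E * h x).
Proof.
move=> mphi mg g0 mh h0 gh mF F0.
rewrite (integral_comp_mul_approx mphi mg g0 mF F0).
rewrite (integral_comp_mul_approx (@measurable_id _ X setT) mh h0 mF F0).
congr (limn _); apply/funext => n.
rewrite (integral_nnsfun_comp_mul mphi mg g0).
rewrite (integral_nnsfun_comp_mul (@measurable_id _ X setT) mh h0).
by apply: eq_fsbigr => y _; rewrite gh.
Qed.

End Density.


(** * Square integrable functions modulo null sets *)

Section L2Theory.
Context d (X : measurableType d) (R : realType) (mu : {measure set X -> \bar R}).
Implicit Types (f g : X -> R[i]) (F G : L2 mu) (r : X -> R).

Lemma sqmodM (z w : R[i]) : sqmod (z * w) = sqmod z * sqmod w.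
Proof. by case: z w => a b [p q]; rewrite /sqmod /=; ring. Qed.

Lemma sqmod_real (r : R) : sqmod r%:C = r ^+ 2.
Proof. by rewrite /sqmod /= expr0n addr0. Qed.

Lemma sqmod_ge0 (z : R[i]) : 0 <= sqmod z.
Proof. by rewrite addr_ge0 ?sqr_ge0. Qed.

Lemma sqmod_eq0 (z : R[i]) : (sqmod z == 0) = (z == 0).
Proof.
by case: z => a b; rewrite /sqmod /= paddr_eq0 ?sqr_ge0// !sqrf_eq0 eq_complex.
Qed.

Lemma measurable_sqmod f : measurable_funC f ->
  measurable_fun setT (fun x => sqmod (f x)).
Proof. by case=> mr mi; apply: measurable_funD; apply: measurable_funX. Qed.

Lemma measurable_funCM f g :
  measurable_funC f -> measurable_funC g -> measurable_funC (fun x => f x * g x).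
Proof.
move=> [mrf mif] [mrg mig]; split.
- rewrite (_ : (fun x => _) = (fun x => complex.Re (f x) * complex.Re (g x) -
      complex.Im (f x) * complex.Im (g x))).
    by apply: measurable_funB; apply: measurable_funM.
  by apply/funext => x; case: (f x) (g x) => ? ? [? ?].
- rewrite (_ : (fun x => _) = (fun x => complex.Re (f x) * complex.Im (g x) +
      complex.Im (f x) * complex.Re (g x))).
    by apply: measurable_funD; apply: measurable_funM.
  by apply/funext => x; case: (f x) (g x) => ? ? [? ?].
Qed.

Lemma measurable_funC_conj f :
  measurable_funC f -> measurable_funC (fun x => (f x)^*).
Proof.
move=> [mrf mif]; split.
- rewrite (_ : (fun x => _) = (fun x => complex.Re (f x)))//.
  by apply/funext => x; case: (f x).
- rewrite (_ : (fun x => _) = (fun x => - complex.Im (f x))).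
    exact: measurableT_comp.
  by apply/funext => x; case: (f x).
Qed.

Lemma measurable_funC_real r :
  measurable_fun setT r -> measurable_funC (fun x => (r x)%:C).
Proof. by move=> mr; split=> //=; exact: measurable_cst. Qed.

Lemma measurable_funC_comp f (phi : X -> X) : measurable_fun setT phi ->
  measurable_funC f -> measurable_funC (fun x => f (phi x)).
Proof.
move=> mphi [mr mi]; split.
- exact: (measurableT_comp mr mphi).
- exact: (measurableT_comp mi mphi).
Qed.

Lemma measurable_L2repr F : measurable_funC (L2repr F).
Proof. by have [] := L2funP (L2repr F). Qed.
Hint Resolve measurable_L2repr : core.

Lemma L2_ext F G : {ae mu, forall x, L2repr F x = L2repr G x} -> F = G.
Proof. by move/pi_L2P; rewrite !L2reprK. Qed.

Lemma L2repr0 : {ae mu, forall x, L2repr (0 : L2 mu) x = 0}.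
Proof.
have := L2reprZ 0 (0 : L2 mu); rewrite scale0r.
by apply: filterS => x ->; rewrite mul0r.
Qed.

Lemma L2repr_lin (a : R[i]) F G :
  {ae mu, forall x, L2repr (a *: F + G) x = a * L2repr F x + L2repr G x}.
Proof. by apply: filterS2 (L2reprD (a *: F) G) (L2reprZ a F) => x -> ->. Qed.

(** Total, so that operators given by formulas can be written as functions; 0 is
    the value at functions that are not square integrable. *)
Definition toL2 f : L2 mu :=
  if pselect (square_integrable mu f) is left p
  then L2class (L2Fun (mem_set p : f \in @L2pred _ X R mu)) else 0.

Lemma toL2E f : square_integrable mu f ->
  {ae mu, forall x, L2repr (toL2 f) x = f x}.
Proof. by rewrite /toL2; case: pselect => // p _; exact: repr_pi. Qed.

Lemma nsq_integral F : ((nsq F)%:E = \int[mu]_x (sqmod (L2repr F x))%:E)%E.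
Proof.
have [mF iF] := L2funP (L2repr F).
rewrite -(@fineK _ (\int[mu]_x (sqmod (L2repr F x))%:E)%E); last first.
  by rewrite ge0_fin_numE// integral_ge0// => x _; rewrite lee_fin sqmod_ge0.
congr EFin; rewrite /nsq /inner /= /L2inner /iprod /=.
apply: eq_Rintegral => x _; case: (L2repr F x) => a b.
by rewrite /sqmod /=; ring.
Qed.

Lemma nsq_integral_ae F f : measurable_funC f ->
  {ae mu, forall x, L2repr F x = f x} ->
  ((nsq F)%:E = \int[mu]_x (sqmod (f x))%:E)%E.
Proof.
move=> mf Ff; rewrite nsq_integral; apply: ge0_ae_eq_integral => //.
- by apply/measurable_EFinP; exact: measurable_sqmod.
- by apply/measurable_EFinP; exact: measurable_sqmod.
- by move=> x _; rewrite lee_fin sqmod_ge0.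
- by move=> x _; rewrite lee_fin sqmod_ge0.
- by apply: filterS Ff => x -> _.
Qed.

Lemma nsq_le F G (c : R) : 0 <= c ->
  {ae mu, forall x, sqmod (L2repr F x) <= c * sqmod (L2repr G x)} ->
  nsq F <= c * nsq G.
Proof.
move=> c0 le; rewrite -lee_fin EFinM !nsq_integral.
have mS (K : L2 mu) : measurable_fun setT (fun x => (sqmod (L2repr K x))%:E).
  by apply/measurable_EFinP; exact: measurable_sqmod.
rewrite -ge0_integralZl//; last by move=> x _; rewrite lee_fin sqmod_ge0.
apply: ae_ge0_le_integral => //.
- by move=> x _; rewrite lee_fin sqmod_ge0.
- by move=> x _; rewrite -EFinM lee_fin mulr_ge0// sqmod_ge0.
- exact: emeasurable_funM.
- by apply: filterS le => x h _; rewrite -EFinM lee_fin.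
Qed.

Lemma inner_ae F G F' G' :
  {ae mu, forall x, L2repr F x * (L2repr G x)^* = L2repr F' x * (L2repr G' x)^*} ->
  inner F G = inner F' G'.
Proof.
move=> FG; rewrite /inner /= /L2inner /iprod.
have mP (K L : L2 mu) : measurable_funC (fun x => L2repr K x * (L2repr L x)^*).
  by apply: measurable_funCM => //; exact: measurable_funC_conj.
have [r1 i1] := mP F G; have [r2 i2] := mP F' G'.
congr (_ +i* _); congr fine; apply: ae_eq_integral => //;
  try exact/measurable_EFinP.
- by apply: filterS FG => x -> _.
- by apply: filterS FG => x -> _.
Qed.

Definition mulop r : operator (L2 mu) (L2 mu) :=
  [set p | {ae mu, forall x, L2repr p.2 x = (r x)%:C * L2repr p.1 x}].

Lemma mulop_single_valued r : single_valued (mulop r).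
Proof.
by move=> F G G' rG rG'; apply: L2_ext; apply: filterS2 rG rG' => x /= -> ->.
Qed.

Lemma mulop_lin r : closed_lin (mulop r).
Proof.
move=> a F G F' G' rF rF' /=.
have rGG : {ae mu, forall x, a * L2repr G x + L2repr G' x =
    (r x)%:C * (a * L2repr F x + L2repr F' x)}.
  by apply: filterS2 rF rF' => x /= -> ->; rewrite mulrDr mulrCA.
by apply: filterS3 (L2repr_lin a G G') (L2repr_lin a F F') rGG => x -> ->.
Qed.

(** Multiplication by a real function is symmetric, whether or not the function
    is bounded, because the two integrands coincide. *)
Lemma mulop_sym r F F' G G' :
  mulop r (F, F') -> mulop r (G, G') -> inner F' G = inner F G'.
Proof.
move=> rF rG; apply: inner_ae; apply: filterS2 rF rG => x /= -> ->.
by rewrite rmorphM/= conj_real_complex -mulrA mulrCA.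
Qed.

Definition mulL2 r F : L2 mu := toL2 (fun x => (r x)%:C * L2repr F x).

Lemma mulL2P r F : measurable_fun setT r ->
  (\int[mu]_x (r x ^+ 2 * sqmod (L2repr F x))%:E < +oo)%E ->
  mulop r (F, mulL2 r F).
Proof.
move=> mr rF; apply: toL2E; split.
  by apply: measurable_funCM => //; exact: measurable_funC_real.
by under eq_integral do rewrite sqmodM sqmod_real.
Qed.

Lemma mulL2_bounded r F (c : R) : measurable_fun setT r ->
  (forall x, r x ^+ 2 <= c) -> mulop r (F, mulL2 r F).
Proof.
move=> mr rc; apply: mulL2P => //.
have [mF iF] := L2funP (L2repr F).
have mS : measurable_fun setT (fun x => (sqmod (L2repr F x))%:E).
  by apply/measurable_EFinP; exact: measurable_sqmod.
apply: (@le_lt_trans _ _ (\int[mu]_x (c%:E * (sqmod (L2repr F x))%:E))%E).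
  apply: ge0_le_integral => //.
  - by move=> x _; rewrite lee_fin mulr_ge0 ?sqr_ge0 ?sqmod_ge0.
  - apply/measurable_EFinP; apply: measurable_funM; last exact/measurable_EFinP.
    exact: measurable_funX.
  - exact: emeasurable_funM.
  - by move=> x _; rewrite -EFinM lee_fin ler_wpM2r// sqmod_ge0.
have c0 : 0 <= c by apply: le_trans (rc point); exact: sqr_ge0.
rewrite ge0_integralZl_EFin// ?lte_mul_pinfty//.
by move=> x _; rewrite lee_fin sqmod_ge0.
Qed.

End L2Theory.
#[global] Hint Resolve measurable_L2repr : core.


(** * The operator of multiplication by a real function *)

Section MultiplicationOperator.
Context d (X : measurableType d) (R : realType) (mu : {measure set X -> \bar R}).
Implicit Types (F G K : L2 mu) (r s : X -> R) (E : set X).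

Lemma indic_in E x : E x -> \1_E x = 1 :> R.
Proof. by move=> Ex; rewrite indicE mem_set. Qed.

Lemma indic_notin E x : ~ E x -> \1_E x = 0 :> R.
Proof. by move=> Ex; rewrite indicE memNset. Qed.

Lemma sqr_indic_le1 E x : (\1_E x : R) ^+ 2 <= 1.
Proof. by rewrite indicE; case: (x \in E); rewrite ?expr1n// expr0n. Qed.

Lemma square_integrable_indic E : measurable E -> (mu E < +oo)%E ->
  square_integrable mu (fun x => (\1_E x : R)%:C).
Proof.
move=> mE Eoo.
split; first by apply: measurable_funC_real; exact: measurable_indic.
under eq_integral do rewrite sqmod_real.
apply: le_lt_trans Eoo.
rewrite -[X in (_ <= mu X)%E]setIT -(integral_indic _ measurableT)//.
apply: ge0_le_integral => //.
- by apply/measurable_EFinP; apply: measurable_funX; exact: measurable_indic.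
- by apply/measurable_EFinP; exact: measurable_indic.
- move=> x _; rewrite lee_fin indicE.
  by case: (x \in E); rewrite ?expr1n// expr0n.
Qed.

Definition supported E F := mulop \1_E (F, F).

Lemma supportedP E F :
  supported E F <-> {ae mu, forall x, ~ E x -> L2repr F x = 0}.
Proof.
split; apply: filterS => x /=.
  by move=> + nE; rewrite indic_notin// mul0r.
have [Ex _|nE /(_ nE)->] := pselect (E x); first by rewrite indic_in// mul1r.
by rewrite mulr0.
Qed.

Definition restr r E : X -> R := fun x => r x * \1_E x.

Lemma mulop_restr r E F G : supported E F -> mulop r (F, G) <-> mulop (restr r E) (F, G).
Proof.
move=> /supportedP sF; split; apply: filterS2 sF => x /= nE ->;
  have [Ex|/nE->] := pselect (E x); rewrite ?mulr0//;
  by rewrite /restr indic_in// mulr1.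
Qed.

Section BoundedOn.
Context r E (c : R).
Hypotheses (mr : measurable_fun setT r) (mE : measurable E).
Hypothesis rc : forall x, E x -> r x ^+ 2 <= c.

Lemma measurable_restr : measurable_fun setT (restr r E).
Proof. by apply: measurable_funM => //; exact: measurable_indic. Qed.

Lemma mulop_indic F : mulop \1_E (F, mulL2 \1_E F).
Proof.
apply: (@mulL2_bounded _ _ _ _ _ _ 1); first exact: measurable_indic.
exact: sqr_indic_le1.
Qed.

Lemma mulop_restr_bounded F : mulop (restr r E) (F, mulL2 (restr r E) F).
Proof.
apply: (@mulL2_bounded _ _ _ _ _ _ (Num.max 0 c)); first exact: measurable_restr.
move=> x; rewrite /restr; have [Ex|nE] := pselect (E x).
  by rewrite indic_in// mulr1 le_max rc// orbT.
by rewrite indic_notin// mulr0 expr0n le_max lexx.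
Qed.

Lemma supported_indic F : supported E (mulL2 \1_E F).
Proof.
apply/supportedP; apply: filterS (mulop_indic F) => x /= -> nE.
by rewrite indic_notin// mul0r.
Qed.

Lemma supported_restr F : supported E (mulL2 (restr r E) F).
Proof.
apply/supportedP; apply: filterS (mulop_restr_bounded F) => x /= -> nE.
by rewrite /restr indic_notin// mulr0 mul0r.
Qed.

Lemma supported_lin (a : R[i]) F G :
  supported E F -> supported E G -> supported E (a *: F + G).
Proof. exact: mulop_lin. Qed.

Lemma supportedB F G :
  supported E F -> supported E G -> supported E (F - G).
Proof.
by move=> sF sG; have := supported_lin (-1) sG sF; rewrite scaleN1r addrC.
Qed.

Lemma mulop_supported F : supported E F -> mulop r (F, mulL2 (restr r E) F).
Proof. by move=> sF; apply/(mulop_restr _ _ sF); exact: mulop_restr_bounded. Qed.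

(** Where r is bounded, the difference of r G and K, cut off to E, is itself an
    admissible test function F, and the hypothesis makes it orthogonal to
    itself. *)
Lemma mulop_on_of_weak G K :
  (forall F, supported E F -> inner (mulL2 (restr r E) F) G = inner F K) ->
  {ae mu, forall x, E x -> L2repr K x = (r x)%:C * L2repr G x}.
Proof.
move=> weak; set rG := mulL2 (restr r E) G; set iK := mulL2 \1_E K.
have sF : supported E (rG - iK).
  by apply: supportedB; [exact: supported_restr|exact: supported_indic].
have /eqP : inner (rG - iK) rG = inner (rG - iK) iK.
  rewrite -(mulop_sym (mulop_restr_bounded _) (mulop_restr_bounded G)).
  by rewrite weak// -(mulop_sym sF (mulop_indic K)).
rewrite -subr_eq0 -innerBr => /eqP/inner_eq0/eqP; rewrite subr_eq0 => /eqP e.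
have := mulop_restr_bounded G; rewrite -/rG e.
have := mulop_indic K; apply: filterS2 => x /= -> + Ex.
by rewrite /restr indic_in// mulr1 mul1r.
Qed.

End BoundedOn.

Section Slices.
Import numFieldNormedType.Exports.
Context (m : X -> R) (mm : measurable_fun setT m) (m0 : forall x, 0 <= m x).

(** On a slice both m and the inverse of m (with 1/0 = 0) are bounded. *)
Definition slice n : set X := m @^-1` ([set 0] `|` `[n.+1%:R^-1, n.+1%:R]).

Lemma measurable_slice n : measurable (slice n).
Proof.
rewrite -[slice n]setTI; apply: mm => //.
by apply: measurableU => //; exact: measurable_itv.
Qed.

Lemma slice_nondecreasing : nondecreasing_seq slice.
Proof.
move=> p q pq; apply/subsetPset => x [/= mx|]; first by left.
rewrite /= in_itv /= => /andP[h1 h2]; right; rewrite /= in_itv /=.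
rewrite (le_trans _ h1) ?(le_trans h2) ?ler_nat//.
by rewrite lef_pV2 ?posrE ?ltr0n// ler_nat.
Qed.

Lemma slice_cover : \bigcup_n slice n = setT.
Proof.
apply/seteqP; split=> // x _; have [mx0|mxn0] := eqVneq (m x) 0.
  by exists 0%N => //; left.
have mx : 0 < m x by rewrite lt_def mxn0 m0.
exists (maxn (Num.truncn (m x)) (Num.truncn (m x)^-1)) => //; right.
rewrite /= in_itv /=; apply/andP; split.
  rewrite invf_ple ?posrE ?ltr0n// ltW// (lt_le_trans (truncnS_gt _))//.
  by rewrite ler_nat ltnS leq_maxr.
by rewrite ltW// (lt_le_trans (truncnS_gt _))// ler_nat ltnS leq_maxl.
Qed.

Lemma slice_bounded n x : slice n x -> m x ^+ 2 <= n.+1%:R ^+ 2.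
Proof.
move=> [/= ->|]; first by rewrite expr0n sqr_ge0.
by rewrite /= in_itv /= => /andP[_ h]; rewrite ler_pXn2r// nnegrE ?m0.
Qed.

Lemma ae_slices (Q : X -> Prop) :
  (forall n, {ae mu, forall x, slice n x -> Q x}) -> {ae mu, forall x, Q x}.
Proof.
move=> /ae_foralln; apply: filterS => x Qx.
by have : [set: X] x by []; rewrite -slice_cover => -[n _]; exact: Qx.
Qed.

(** Cutting off is an orthogonal projection, so the squared distance is
    |F|^2 - |F 1_slice|^2, which tends to 0 by monotone convergence. *)
Lemma slice_dense F (e : R) : 0 < e ->
  exists n, nsq (F - mulL2 \1_(slice n) F) < e.
Proof.
move=> e0; set G := fun n => mulL2 \1_(slice n) F.
have GP n : mulop \1_(slice n) (F, G n) by apply: mulop_indic; exact: measurable_slice.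
have nG n : nsq (F - G n) = nsq F - nsq (G n).
  have sG : supported (slice n) (G n) by apply: supported_indic; exact: measurable_slice.
  have o : inner F (G n) = inner (G n) (G n) by rewrite -(mulop_sym (GP n) sG).
  by rewrite nsqD nsqN innerNr o /nsq; case: (inner (G n) (G n)) => a b /=; ring.
have cvG : ((nsq (G n))%:E @[n --> \oo] --> (nsq F)%:E)%E.
  have mS : measurable_fun setT (fun x => (sqmod (L2repr F x))%:E).
    by apply/measurable_EFinP; exact: measurable_sqmod.
  have nGE n : ((nsq (G n))%:E = \int[mu]_(x in slice n) (sqmod (L2repr F x))%:E)%E.
    rewrite (nsq_integral_ae _ (GP n)); last first.
      apply: measurable_funCM => //; apply: measurable_funC_real.
      by apply: measurable_indic; exact: measurable_slice.
    rewrite [RHS]integral_mkcond; apply: eq_integral => x _.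
    rewrite sqmodM sqmod_real patchE indicE.
    by case: (x \in slice n); rewrite ?expr1n ?expr0n ?mul1r ?mul0r.
  under eq_fun do rewrite nGE.
  rewrite nsq_integral -slice_cover.
  apply: ge0_nondecreasing_set_cvg_integral => //.
  - exact: slice_nondecreasing.
  - exact: measurable_slice.
  - by move=> n; exact: measurable_funTS.
  - by move=> n x _; rewrite lee_fin sqmod_ge0.
have := cvG; move/fine_cvg => /= {}cvG.
have [n _ /(_ n (leqnn n)) /=] := (cvgrPdist_lt _ _).1 cvG _ e0.
by move=> h; exists n; rewrite nG; exact: le_lt_trans (ler_norm _) h.
Qed.

Lemma mulop_dense : densely_defined (mulop (mu := mu) m).
Proof.
move=> F e e0; have e2 : 0 < e ^+ 2 by rewrite exprn_gt0.
have [n nn] := slice_dense F e2; exists (mulL2 \1_(slice n) F).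
  exists (mulL2 (restr m (slice n)) (mulL2 \1_(slice n) F)).
  apply: (mulop_supported mm (measurable_slice n) (@slice_bounded n)).
  by apply: supported_indic; exact: measurable_slice.
by rewrite hnormE -(@ltr_pXn2r _ 2)// ?nnegrE ?sqrtr_ge0 ?ltW// sqr_sqrtr ?nsq_ge0.
Qed.

Lemma mulop_of_weak G K :
  (forall F F', mulop m (F, F') -> inner F' G = inner F K) -> mulop m (G, K).
Proof.
move=> weak; apply: ae_slices => n.
apply: (mulop_on_of_weak mm (measurable_slice n) (@slice_bounded n)) => F sF.
by apply: weak; apply: (mulop_supported mm (measurable_slice n) (@slice_bounded n)).
Qed.

Lemma mulop_selfadjoint : selfadjoint (mulop (mu := mu) m).
Proof.
split; first exact: mulop_dense.
apply/seteqP; split=> -[G K]; first exact: mulop_of_weak.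
by move=> mG F F' mF; exact: mulop_sym mF mG.
Qed.

Lemma mulop_positive : positive_op (mulop (mu := mu) m).
Proof.
move=> F F' mF; rewrite [_ F' F]complexE.
have -> : complex.Im (inner F' F) = 0.
  have /(congr1 (@complex.Im R)) := innerC F F'.
  by rewrite -(mulop_sym mF mF); case: (inner F' F) => a b /=; lra.
rewrite mulr0 addr0 ler0c /inner /= /L2inner /iprod /=.
apply: fine_ge0.
rewrite (@ae_eq_integral _ _ _ mu _ (fun x => (m x * sqmod (L2repr F x))%:E))//.
- by apply: integral_ge0 => x _; rewrite lee_fin mulr_ge0// sqmod_ge0.
- apply/measurable_EFinP.
  have [] // := measurable_funCM (measurable_L2repr F')
    (measurable_funC_conj (measurable_L2repr F)).
- apply/measurable_EFinP; apply: measurable_funM => //.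
  exact: measurable_sqmod.
- apply: filterS mF => x /= -> _; congr EFin.
  by case: (L2repr F x) => a b; rewrite /sqmod /=; ring.
Qed.
End Slices.
End MultiplicationOperator.


(** * Uniqueness of the positive square root of a multiplication operator *)

Section SquareRoot.
Context d (X : measurableType d) (R : realType) (mu : {measure set X -> \bar R}).
Context (m : X -> R) (mm : measurable_fun setT m) (m0 : forall x, 0 <= m x).
Context (P : operator (L2 mu) (L2 mu)).
Hypotheses (sP : selfadjoint P) (pP : positive_op P).
Hypothesis PP : op_comp P P = op_comp (mulop m) (mulop m).

(** The ratio 3/2 is what makes multiplication by m differ from the scalar a by
    at most a/2 on the band. *)
Definition band (a : R) : set X := m @^-1` `[a, 3 / 2 * a].

Lemma measurable_band a : measurable (band a).
Proof. by rewrite -[band a]setTI; apply: mm => //; exact: measurable_itv. Qed.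

Lemma band_bounded a x : band a x -> m x ^+ 2 <= (3 / 2 * a) ^+ 2.
Proof.
rewrite /band /= in_itv /= => /andP[h1 h2].
by rewrite ler_pXn2r// nnegrE ?m0// (le_trans (m0 x) h2).
Qed.

Lemma sqrt_on_band a (F : L2 mu) : 0 < a -> supported (band a) F ->
  P (F, mulL2 (restr m (band a)) F).
Proof.
move=> a0; set E := band a; set N := mulL2 _.
have mE : measurable E := measurable_band a.
have NP F' : mulop (restr m E) (F', N F').
  exact: (mulop_restr_bounded mm mE (@band_bounded a)).
have sN F' : supported E (N F').
  exact: (supported_restr mm mE (@band_bounded a)).
have lN : linear N.
  move=> b G K; apply: (mulop_single_valued (NP _)).
  exact: mulop_lin (NP _) (NP _).
have mN F' : supported E F' -> mulop m (F', N F').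
  exact: (mulop_supported mm mE (@band_bounded a)).
apply: (selfadjoint_sqrt_agree (V := supported E) (N := N) sP pP lN a0) => G sG.
- exact: sN.
- by rewrite addrC -scaleNr; apply: supported_lin.
- by rewrite PP; exists (N G); apply: mN.
- exact/esym/(mulop_sym (NP G) (NP (N G))).
- apply: nsq_le; first exact: sqr_ge0.
  rewrite addrC -scaleNr.
  apply: filterS3 (L2repr_lin (- a%:C) G (N G)) ((supportedP _ _).1 sG) (NP G).
  move=> x -> /= sGx ->; rewrite mulNr addrC /restr.
  have [Ex|nE] := pselect (E x); last first.
    by rewrite sGx// !mulr0 subr0 /sqmod /= expr0n addr0 mulr0.
  rewrite indic_in// mulr1 -mulrBl -rmorphB sqmodM sqmod_real.
  rewrite ler_wpM2r ?sqmod_ge0//.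
  move: Ex; rewrite /E /band /= in_itv /= => /andP[h1 h2].
  by rewrite ler_pXn2r// ?nnegrE; lra.
Qed.

(** |P F|^2 = <P P F, F> = <m^2 F, F> = 0. *)
Lemma sqrt_on_kernel (F : L2 mu) : supported (m @^-1` [set 0]) F -> P (F, 0).
Proof.
move=> /supportedP sF.
have mF0 : mulop m (F, 0).
  have := L2repr0 mu; apply: filterS2 sF => x sFx /= ->.
  by have [->|/eqP mx] := eqVneq (m x) 0; rewrite ?mul0r// sFx// mulr0.
have m00 : mulop m ((0 : L2 mu), (0 : L2 mu)).
  by apply: filterS (L2repr0 mu) => x /= ->; rewrite mulr0.
have [G /= PFG PG0] : op_comp P P (F, 0) by rewrite PP; exists 0.
suff -> : 0 = G by [].
apply/esym/inner_eq0; rewrite (selfadjoint_sym sP PFG PG0).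
by rewrite innerC inner0l raddf0.
Qed.

(** P G is identified piecewise: on the bands with rational lower end a in
    ]2/3 m, m[, which cover {m > 0}, and on {m = 0}. On each piece E the symmetry
    <P F, G> = <F, P G> with F supported in E, where P F is known, gives
    P G = m G on E. *)
Lemma sqrt_mulop_unique : P = mulop m.
Proof.
apply: (selfadjoint_maximal sP (mulop_selfadjoint mu mm m0)) => -[G K] PGK.
have weak_on E : measurable E -> (exists c, forall x, E x -> m x ^+ 2 <= c) ->
    (forall F, supported E F -> P (F, mulL2 (restr m E) F)) ->
    {ae mu, forall x, E x -> L2repr K x = (m x)%:C * L2repr G x}.
  move=> mE [c mc] PE; apply: (mulop_on_of_weak mm mE mc) => F sF.
  exact: (selfadjoint_sym sP (PE _ sF) PGK).
have on_kernel : {ae mu, forall x, m x = 0 -> L2repr K x = (m x)%:C * L2repr G x}.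
  have mE : measurable (m @^-1` [set 0]).
    by rewrite -[_ @^-1` _]setTI; apply: mm.
  have bE : forall x, (m @^-1` [set 0]) x -> m x ^+ 2 <= 0.
    by move=> x /= ->; rewrite expr0n.
  apply: (weak_on (m @^-1` [set 0]) mE (ex_intro _ 0 bE)) => F sF.
  suff -> : mulL2 (restr m (m @^-1` [set 0])) F = 0 by exact: sqrt_on_kernel.
  apply: L2_ext; have := mulop_restr_bounded mm mE bE F.
  apply: filterS2 (L2repr0 mu) => x -> /= ->; rewrite /restr.
  have [/= ->|nE] := pselect ((m @^-1` [set 0]) x); first by rewrite mul0r mul0r.
  by rewrite indic_notin// mulr0 mul0r.
(* an enumeration of the rationals; the default 1 only fills unused codes *)
pose q n : R := ratr (odflt 1 (pickle_inv n)).
have on_bands : {ae mu, forall x, forall n, 0 < q n -> band (q n) x ->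
    L2repr K x = (m x)%:C * L2repr G x}.
  apply: ae_foralln => n; have [q0|q0] := ltP 0 (q n); last exact: aeW.
  have := weak_on _ (measurable_band (q n)) (ex_intro _ _ (@band_bounded (q n)))
    (fun F => @sqrt_on_band _ F q0).
  by apply: filterS => x h _; exact: h.
apply: filterS2 on_kernel on_bands => x kx bx /=.
have [/kx //|mx] := eqVneq (m x) 0.
have mx0 : 0 < m x by rewrite lt_def mx m0.
have [r] : exists r : rat, ratr r \in `]2 / 3 * m x, m x[.
  by apply: rat_in_itvoo; lra.
rewrite in_itv /= => /andP[h1 h2].
have qr : q (pickle r) = ratr r by rewrite /q pickleK_inv.
apply: (bx (pickle r)); rewrite qr; first lra.
by rewrite /band /= in_itv /=; apply/andP; split; lra.
Qed.

End SquareRoot.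


(** * One weighted composition operator *)

Section WeightedComposition.
Context d (X : measurableType d) (R : realType) (mu : {measure set X -> \bar R}).
Implicit Types (f : X -> R[i]) (F G : L2 mu) (w : X -> R[i]).

Lemma weighted_measure_eq0 w (A : set X) : measurable_funC w -> measurable A ->
  weighted_measure mu w A = 0 <-> {ae mu, forall x, A x -> w x = 0}.
Proof.
move=> mw mA.
have mS : measurable_fun A (fun x => (sqmod (w x))%:E).
  by apply/measurable_funTS/measurable_EFinP; exact: measurable_sqmod.
have -> : weighted_measure mu w A = (\int[mu]_(x in A) `|(sqmod (w x))%:E|)%E.
  by apply: eq_integral => x _; rewrite gee0_abs// lee_fin sqmod_ge0.
rewrite (ae_eq_integral_abs mu mA mS); split; apply: filterS => x h Ax.
  by have [/eqP] := h Ax; rewrite sqmod_eq0 => /eqP.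
by rewrite (h Ax) /sqmod /= expr0n addr0.
Qed.

Lemma ae_weighted w (Q : X -> Prop) : measurable_funC w ->
  {ae weighted_measure mu w, forall x, Q x} <->
  {ae mu, forall x, w x <> 0 -> Q x}.
Proof.
move=> mw; split=> -[N [mN N0 sN]].
  have := (weighted_measure_eq0 mw mN).1 N0; apply: filterS => x h wx.
  by apply: contrapT => nQ; apply/wx/h/sN.
pose Z := (fun x => sqmod (w x)) @^-1` [set 0].
have mZ : measurable Z.
  by rewrite -[Z]setTI; apply: (measurable_sqmod mw).
have mNZ : measurable (N `|` Z) by apply: measurableU.
exists (N `|` Z); split => //.
  apply/(weighted_measure_eq0 mw mNZ).
  exists N; split => // x /= h; apply: contrapT => nN; apply: h => -[//|].
  by rewrite /Z /= => /eqP; rewrite sqmod_eq0 => /eqP.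
move=> x /= nQ; have [wx|wx] := pselect (w x = 0).
  by right; rewrite /Z /= wx /sqmod /= expr0n addr0.
by left; apply: sN => /= h; apply/nQ/h.
Qed.

Section Density.
Context (phi : X -> X) (w : X -> R[i]) (h : X -> \bar R).
Hypotheses (mphi : measurable_fun setT phi) (mw : measurable_funC w).
Hypothesis hh : is_RN_density mu phi w h.

Lemma integral_wcomp f : measurable_funC f ->
  (\int[mu]_x (sqmod (w x * f (phi x)))%:E =
   \int[mu]_x ((sqmod (f x))%:E * h x))%E.
Proof.
move=> mf; have [mh h0 hE] := hh.
rewrite -(integral_comp_density (mu := mu) (phi := phi)
  (g := fun x => (sqmod (w x))%:E) (h := h) (F := fun x => sqmod (f x)))//.
- by apply: eq_integral => x _; rewrite sqmodM mulrC EFinM.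
- by apply/measurable_EFinP; exact: measurable_sqmod.
- by move=> x; rewrite lee_fin sqmod_ge0.
- exact: measurable_sqmod.
- by move=> x; rewrite sqmod_ge0.
Qed.

(** An exceptional null set N is harmless after composition with phi: w vanishes
    almost everywhere on phi^-1 N, because the integral of |w|^2 over it is the
    integral of h over N. *)
Lemma ae_comp (Q : X -> Prop) : {ae mu, forall x, Q x} ->
  {ae mu, forall x, w x <> 0 -> Q (phi x)}.
Proof.
move=> [N [mN N0 sN]]; have [mh h0 hE] := hh.
have mphiN : measurable (phi @^-1` N) by rewrite -[_ @^-1` _]setTI; apply: mphi.
have /(weighted_measure_eq0 mw mphiN) : weighted_measure mu w (phi @^-1` N) = 0.
  have := hE _ mN; rewrite /pushforward => ->.
  by apply: null_set_integral => //; exact: measurable_funTS.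
apply: filterS => x wx wn0; apply: contrapT => nQ.
by apply/wn0/wx/sN.
Qed.

Lemma ae_comp_neq0 (A : set X) : measurable A ->
  {ae mu, forall x, A x -> h x = 0} ->
  {ae mu, forall x, w x <> 0 -> ~ A (phi x)}.
Proof.
move=> mA hA; have [mh h0 hE] := hh.
have mphiA : measurable (phi @^-1` A) by rewrite -[_ @^-1` _]setTI; apply: mphi.
have /(weighted_measure_eq0 mw mphiA) : weighted_measure mu w (phi @^-1` A) = 0.
  have := hE _ mA; rewrite /pushforward => ->.
  rewrite (ae_eq_integral (cst 0%E))//; first by rewrite integral0.
  exact: measurable_funTS.
by apply: filterS => x wx wn0 /wx.
Qed.

End Density.
End WeightedComposition.

(** Every F in the domain satisfies \int |F|^2 h < +oo, hence vanishes where h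
    is infinite. The indicators of the parts of finite measure of {h = +oo} are
    therefore orthogonal to the domain; by density these parts are null. *)
Lemma RN_density_finite d (X : measurableType d) (R : realType)
    (mu : {sigma_finite_measure set X -> \bar R}) (phi : X -> X) (w : X -> R[i])
    (h : X -> \bar R) :
  measurable_fun setT phi -> measurable_funC w ->
  is_RN_density mu phi w h -> densely_defined (wcomp mu phi w) ->
  {ae mu, forall x, h x \is a fin_num}.
Proof.
move=> mphi mw hh dd; have [mh h0 hE] := hh.
have [S SE Sfin] := sigma_finiteT mu.
have mhoo : measurable (h @^-1` [set +oo%E]).
  by rewrite -[_ @^-1` _]setTI; apply: mh => //; exact: emeasurable_set1.
pose A n := S n `&` h @^-1` [set +oo%E].
have mA n : measurable (A n) by apply: measurableI => //; have [] := Sfin n.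
have LA n : square_integrable mu (fun x => (\1_(A n) x : R)%:C).
  have [mS Soo] := Sfin n.
  apply: square_integrable_indic => //; apply: le_lt_trans Soo.
  by apply: le_measure; rewrite ?inE//; exact: subIsetl.
have A0 n : toL2 mu (fun x => (\1_(A n) x : R)%:C) = 0.
  apply: (dense_orth_eq0 dd) => F [G FG].
  have : {ae mu, forall x, h x = +oo%E -> L2repr F x = 0}.
    have : mu.-integrable setT (fun x => ((sqmod (L2repr F x))%:E * h x)%E).
      have mI : measurable_fun setT (fun x => ((sqmod (L2repr F x))%:E * h x)%E).
        apply: emeasurable_funM => //; apply/measurable_EFinP.
        exact: measurable_sqmod.
      apply/integrableP; split => //.
      under eq_integral do rewrite gee0_abs ?mule_ge0 ?lee_fin ?sqmod_ge0//.
      rewrite -(integral_wcomp mphi mw hh)// -(nsq_integral_ae _ FG) ?ltry//.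
      by apply: measurable_funCM => //; exact: measurable_funC_comp.
    move/(integrable_ae measurableT); apply: filterS => x /(_ I) + hx.
    rewrite hx; apply: contraPP => /eqP; rewrite -sqmod_eq0 => F0.
    by rewrite muleC gt0_mulye// lte_fin lt_def F0 sqmod_ge0.
  move=> F0; rewrite -(inner0l (0 : L2 mu)); apply: inner_ae.
  apply: filterS3 F0 (toL2E (LA n)) (L2repr0 mu) => x Fx -> ->.
  have [[_ hx]|nA] := pselect (A n x); first by rewrite Fx// !mul0r.
  by rewrite indic_notin// rmorph0 mulr0 mul0r.
have : {ae mu, forall x n, \1_(A n) x = 0 :> R}.
  apply: ae_foralln => n; have := toL2E (LA n); rewrite A0.
  by apply: filterS2 (L2repr0 mu) => x -> [].
apply: filterS => x Ax; have [n _ Sx] : (\bigcup_n S n) x by rewrite -SE.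
have := Ax n; rewrite ge0_fin_numE// ltey => /eqP.
by apply: contraLR; rewrite negbK => /eqP hx; rewrite indic_in ?oner_eq0.
Qed.


(** * The components of the polar factor *)

Section PolarFactor.
Context d (X : measurableType d) (R : realType) (mu : {measure set X -> \bar R}).
Context (phi : X -> X) (w : X -> R[i]) (h : X -> \bar R) (m : X -> R).
Hypotheses (mphi : measurable_fun setT phi) (mw : measurable_funC w).
Hypotheses (hh : is_RN_density mu phi w h) (mm : measurable_fun setT m).
Hypotheses (m0 : forall x, 0 <= m x).
Hypothesis hm : {ae mu, forall x, (h x <= (m x ^+ 2)%:E)%E}.
Implicit Types F G : L2 mu.

Lemma measurable_inv_modulus : measurable_fun setT (fun x => (m x)^-1).
Proof.
rewrite (_ : (fun x => _) = (fun x => m x `^ (-1))).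
  exact: (measurableT_comp (measurable_powR _) mm).
by apply/funext => x; rewrite powR_inv1.
Qed.

(** F / m need not be square integrable; only w * (F / m) o phi is. *)
Definition normalize F : X -> R[i] := fun x => ((m x)^-1)%:C * L2repr F x.

Lemma measurable_normalize F : measurable_funC (normalize F).
Proof.
apply: measurable_funCM => //; apply: measurable_funC_real.
exact: measurable_inv_modulus.
Qed.

Definition polar_factor F : L2 mu :=
  toL2 mu (fun x => w x * normalize F (phi x)).

Lemma measurable_polar_factor F :
  measurable_funC (fun x => w x * normalize F (phi x)).
Proof.
apply: measurable_funCM => //; apply: measurable_funC_comp => //.
exact: measurable_normalize.
Qed.

(** Integrability: \int |w|^2 |F / m|^2 o phi = \int |F / m|^2 h <= \int |F|^2, as
    h <= m^2. *)
Lemma polar_factorE F :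
  {ae mu, forall x, L2repr (polar_factor F) x = w x * normalize F (phi x)}.
Proof.
apply: toL2E; split; first exact: measurable_polar_factor.
rewrite (integral_wcomp mphi mw hh); last exact: measurable_normalize.
have [mF iF] := L2funP (L2repr F); have [mh h0 _] := hh.
apply: le_lt_trans iF; apply: ae_ge0_le_integral => //.
- by move=> x _; rewrite mule_ge0// lee_fin sqmod_ge0.
- apply: emeasurable_funM => //; apply/measurable_EFinP; apply: measurable_sqmod.
  exact: measurable_normalize.
- by move=> x _; rewrite lee_fin sqmod_ge0.
- by apply/measurable_EFinP; exact: measurable_sqmod.
apply: filterS hm => x hx _.
apply: (@le_trans _ _ ((sqmod (normalize F x))%:E * (m x ^+ 2)%:E)%E).
  by rewrite lee_wpmul2l// lee_fin sqmod_ge0.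
rewrite -EFinM lee_fin /normalize sqmodM sqmod_real.
have [->|mx] := eqVneq (m x) 0.
  by rewrite invr0 expr0n !mul0r sqmod_ge0.
by rewrite le_eqVlt; apply/orP; left; apply/eqP; field.
Qed.

Lemma polar_factor_lin : linear polar_factor.
Proof.
move=> a F G; apply: L2_ext.
have E1 := polar_factorE (a *: F + G).
have E2 : {ae mu, forall x, a * L2repr (polar_factor F) x + L2repr (polar_factor G) x
    = w x * (a * normalize F (phi x) + normalize G (phi x))}.
  apply: filterS2 (polar_factorE F) (polar_factorE G) => x -> ->.
  by rewrite mulrDr mulrCA.
have E3 : {ae mu, forall x, w x * normalize (a *: F + G) (phi x) =
    w x * (a * normalize F (phi x) + normalize G (phi x))}.
  apply: filterS (ae_comp mphi mw hh (L2repr_lin a F G)) => x lx.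
  have [->|/lx e] := pselect (w x = 0); first by rewrite !mul0r.
  by rewrite /normalize e mulrDr mulrCA.
have E4 := L2repr_lin a (polar_factor F) (polar_factor G).
have E12 : {ae mu, forall x, L2repr (polar_factor (a *: F + G)) x =
    w x * (a * normalize F (phi x) + normalize G (phi x))}.
  by apply: filterS2 E1 E3 => x -> ->.
by apply: filterS3 E12 E2 E4 => x -> + -> => ->.
Qed.

Lemma nsq_polar_factor F :
  ((nsq (polar_factor F))%:E = \int[mu]_x ((sqmod (normalize F x))%:E * h x))%E.
Proof.
rewrite (nsq_integral_ae (measurable_polar_factor F) (polar_factorE F)).
by rewrite (integral_wcomp mphi mw hh)//; exact: measurable_normalize.
Qed.

(** h <= m^2 vanishes where m does, and the set phi^-1 {h = 0} carries no mass of the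
    measure with density |w|^2. *)
Lemma ae_modulus_comp_neq0 : {ae mu, forall x, w x <> 0 -> m (phi x) <> 0}.
Proof.
have mZ : measurable (m @^-1` [set 0]).
  by rewrite -[_ @^-1` _]setTI; apply: mm.
have [mh h0 _] := hh.
apply: (ae_comp_neq0 mphi mw hh mZ); apply: filterS hm => x + /= mx.
by rewrite mx expr0n /= => hx; apply/eqP; rewrite eq_le hx h0.
Qed.

Lemma wcomp_polar F F' G :
  mulop m (F, F') -> wcomp mu phi w (F, G) <-> G = polar_factor F'.
Proof.
move=> mF.
have E : {ae mu, forall x, L2repr (polar_factor F') x = w x * L2repr F (phi x)}.
  apply: filterS3 (polar_factorE F') (ae_comp mphi mw hh mF)
    ae_modulus_comp_neq0 => x -> /= F'x mx.
  have [->|wx] := pselect (w x = 0); first by rewrite !mul0r.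
  rewrite /normalize F'x// [_%:C * (_ * _)]mulrA -(rmorphM (real_complex R)).
  by rewrite mulVf ?rmorph1 ?mul1r//; exact/eqP/mx.
split=> [FG|->]; last exact: E.
by apply: L2_ext; apply: filterS2 FG E => x /= -> ->.
Qed.

End PolarFactor.

(** Commutation applied to f says m * w * (f / m) o phi = w * f o phi. For f the
    indicator of a set A of finite measure on which m is bounded, dividing by
    w (f / m) o phi gives m = m o phi on phi^-1 A where w <> 0. *)
Lemma polar_factor_commutesP d (X : measurableType d) (R : realType)
    (mu : {sigma_finite_measure set X -> \bar R}) (phi : X -> X) (w : X -> R[i])
    (h : X -> \bar R) (m : X -> R) :
  measurable_fun setT phi -> measurable_funC w -> is_RN_density mu phi w h ->
  measurable_fun setT m -> (forall x, 0 <= m x) ->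
  {ae mu, forall x, (h x <= (m x ^+ 2)%:E)%E} ->
  (forall F G : L2 mu, mulop m (F, G) ->
    mulop m (polar_factor phi w m F, polar_factor phi w m G)) <->
  {ae mu, forall x, w x <> 0 -> m (phi x) = m x}.
Proof.
move=> mphi mw hh mm m0 hm.
have UE := polar_factorE mphi mw hh mm m0 hm.
have mn0 := ae_modulus_comp_neq0 mphi mw hh mm hm.
split=> [comm|comm F G mFG].
  have [S SE Sfin] := sigma_finiteT mu.
  pose A n k := S n `&` slice m k.
  have mA n k : measurable (A n k).
    by apply: measurableI; [have [] := Sfin n|exact: measurable_slice].
  suff on n k : {ae mu, forall x, A n k (phi x) -> w x <> 0 -> m (phi x) = m x}.
    have : {ae mu, forall x n k, A n k (phi x) -> w x <> 0 -> m (phi x) = m x}.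
      by apply: ae_foralln => n; apply: ae_foralln => k; exact: on.
    apply: filterS => x cx wx.
    have [n _ Sn] : (\bigcup_n S n) (phi x) by rewrite -SE.
    have [k _ Sk] : (\bigcup_k slice m k) (phi x) by rewrite slice_cover.
    by apply: (cx n k) => //; split.
  pose F := toL2 mu (fun x => (\1_(A n k) x : R)%:C).
  have FE : {ae mu, forall x, L2repr F x = (\1_(A n k) x : R)%:C}.
    have [mS Soo] := Sfin n.
    apply/toL2E/square_integrable_indic => //; apply: le_lt_trans Soo.
    by apply: le_measure; rewrite ?inE//; exact: subIsetl.
  have sF : supported (slice m k) F.
    apply/supportedP; apply: filterS FE => x -> nS.
    by rewrite indic_notin// => -[].
  have mF := mulop_supported mm (measurable_slice mm k)
    (@slice_bounded _ _ _ _ m0 k) sF.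
  set G := mulL2 _ F in mF.
  have UG : {ae mu, forall x, L2repr (polar_factor phi w m G) x =
      w x * L2repr F (phi x)}.
    exact: ((wcomp_polar mphi mw hh mm m0 hm _ mF).2 erefl).
  have UU : {ae mu, forall x, w x * L2repr F (phi x) =
      (m x)%:C * (w x * normalize m F (phi x))}.
    by apply: filterS3 UG (UE F) (comm _ _ mF) => x <- <-.
  apply: filterS3 UU (ae_comp mphi mw hh FE) mn0 => x e Fx mx Ax wx.
  move: e; rewrite /normalize Fx// indic_in// !mulr1 mulrCA => e.
  have {e} : (1 : R[i]) = (m x / m (phi x))%:C.
    rewrite rmorphM/=; apply: (mulfI (x := w x)); first exact/eqP.
    by rewrite mulr1.
  by case=> /esym/divr1_eq.
have E : {ae mu, forall x, w x * normalize m G (phi x) =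
    (m x)%:C * (w x * normalize m F (phi x))}.
  apply: filterS3 (ae_comp mphi mw hh mFG) comm mn0 => x /= Gx mx m0x.
  have [->|wx] := pselect (w x = 0); first by rewrite !mul0r mulr0.
  by rewrite /normalize Gx// mx//; ring.
by apply: filterS3 (UE F) (UE G) E => x /= -> ->.
Qed.


(** * The pair of weighted composition operators *)

Section WeightedCompositionPair.
Context d (X : measurableType d) (R : realType).
Context (mu : {sigma_finite_measure set X -> \bar R}).
Context (phi1 phi2 : X -> X) (w1 w2 : X -> R[i]) (h1 h2 : X -> \bar R).
Hypotheses (mphi1 : measurable_fun setT phi1) (mphi2 : measurable_fun setT phi2).
Hypotheses (mw1 : measurable_funC w1) (mw2 : measurable_funC w2).
Hypotheses (hh1 : is_RN_density mu phi1 w1 h1) (hh2 : is_RN_density mu phi2 w2 h2).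
Hypothesis hfin :
  {ae mu, forall x, h1 x \is a fin_num /\ h2 x \is a fin_num}.

Definition modulus x : R := Num.sqrt (fine (h1 x) + fine (h2 x)).
Local Notation m := modulus.

Lemma modulus_ge0 x : 0 <= m x. Proof. exact: sqrtr_ge0. Qed.

Lemma measurable_modulus : measurable_fun setT m.
Proof.
have [mh1 _ _] := hh1; have [mh2 _ _] := hh2.
apply: (measurableT_comp (continuous_measurable_fun (@sqrt_continuous R))).
by apply: measurable_funD; apply: (measurableT_comp (fine_measurable measurableT)).
Qed.

Lemma sqr_modulus : {ae mu, forall x, (h1 x + h2 x)%E = (m x ^+ 2)%:E}.
Proof.
have [_ h10 _] := hh1; have [_ h20 _] := hh2.
apply: filterS hfin => x [f1 f2].
by rewrite /m sqr_sqrtr ?addr_ge0 ?fine_ge0// EFinD !fineK.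
Qed.

Lemma density1_le : {ae mu, forall x, (h1 x <= (m x ^+ 2)%:E)%E}.
Proof.
by have [_ h0 _] := hh2; apply: filterS sqr_modulus => x <-; rewrite leeDl.
Qed.

Lemma density2_le : {ae mu, forall x, (h2 x <= (m x ^+ 2)%:E)%E}.
Proof.
by have [_ h0 _] := hh1; apply: filterS sqr_modulus => x <-; rewrite leeDr.
Qed.

Lemma integral_densityD (f : X -> R[i]) : measurable_funC f ->
  (\int[mu]_x ((sqmod (f x))%:E * h1 x) + \int[mu]_x ((sqmod (f x))%:E * h2 x) =
   \int[mu]_x (m x ^+ 2 * sqmod (f x))%:E)%E.
Proof.
move=> mf; have [mh1 h10 _] := hh1; have [mh2 h20 _] := hh2.
have mS : measurable_fun setT (fun x => (sqmod (f x))%:E).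
  exact/measurable_EFinP/measurable_sqmod.
rewrite -ge0_integralD//; last 4 first.
- by move=> x _; rewrite mule_ge0// lee_fin sqmod_ge0.
- exact: emeasurable_funM.
- by move=> x _; rewrite mule_ge0// lee_fin sqmod_ge0.
- exact: emeasurable_funM.
apply: ge0_ae_eq_integral => //.
- by apply: emeasurable_funD; apply: emeasurable_funM.
- apply/measurable_EFinP; apply: measurable_funM; last exact/measurable_EFinP.
  by apply: measurable_funX; exact: measurable_modulus.
- by move=> x _; rewrite adde_ge0// mule_ge0// lee_fin sqmod_ge0.
- by move=> x _; rewrite lee_fin mulr_ge0 ?sqr_ge0 ?sqmod_ge0.
- by apply: filterS sqr_modulus => x hx _; rewrite -ge0_muleDr// hx -EFinM mulrC.
Qed.

Let mm := measurable_modulus.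
Let m0 := modulus_ge0.
Local Notation M := (mulop (mu := mu) m).
Local Notation T := (column (wcomp mu phi1 w1) (wcomp mu phi2 w2)).

Definition pair_factor (F : L2 mu) : (L2 mu * L2 mu)%type :=
  (polar_factor phi1 w1 m F, polar_factor phi2 w2 m F).
Local Notation u := pair_factor.

Lemma pair_factor_lin : linear u.
Proof.
move=> a F G; rewrite /u.
rewrite (polar_factor_lin mphi1 mw1 hh1 mm m0 density1_le).
by rewrite (polar_factor_lin mphi2 mw2 hh2 mm m0 density2_le).
Qed.

(* the initial space of the polar factor is the space of functions supported
   here *)
Let carrier : set X := ~` (m @^-1` [set 0]).

Let mcarrier : measurable carrier.
Proof. by apply: measurableC; rewrite -[_ @^-1` _]setTI; apply: mm. Qed.

(** |U F|^2 = \int |F / m|^2 (h1 + h2) = \int_(m <> 0) |F|^2. *)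
Lemma nsq_pair_factor F : nsq (u F) = nsq (mulL2 \1_carrier F).
Proof.
have -> : nsq (u F) = nsq (polar_factor phi1 w1 m F) +
    nsq (polar_factor phi2 w2 m F) by rewrite /nsq raddfD.
apply: EFin_inj; rewrite EFinD.
have n1 := nsq_polar_factor mphi1 mw1 hh1 mm m0 density1_le F.
have n2 := nsq_polar_factor mphi2 mw2 hh2 mm m0 density2_le F.
apply: (etrans (congr2 (fun a b => (a + b)%E) n1 n2)).
have mN := measurable_normalize mm m0 F.
have mI : measurable_funC (fun x => (\1_carrier x : R)%:C * L2repr F x).
  apply: measurable_funCM => //; apply: measurable_funC_real.
  exact: measurable_indic.
rewrite (integral_densityD mN) (nsq_integral_ae mI (mulop_indic mcarrier F)).
apply: eq_integral => x _; congr EFin.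
rewrite /normalize !sqmodM !sqmod_real.
have [mx|/eqP mx] := eqVneq (m x) 0.
  by rewrite mx indic_notin//= ?expr0n ?mul0r//; apply.
rewrite indic_in// expr1n mul1r.
by field; exact/eqP.
Qed.

Lemma nsq_pair_factor_ran F G : M (F, G) -> nsq (u G) = nsq G.
Proof.
move=> mFG; rewrite nsq_pair_factor; congr nsq; apply: L2_ext.
apply: filterS2 (mulop_indic mcarrier G) mFG => x /= -> ->.
have [mx|/eqP mx] := eqVneq (m x) 0; first by rewrite mx mul0r mulr0.
by rewrite indic_in// mul1r.
Qed.

Lemma nsq_pair_factor_le F : nsq (u F) <= nsq F.
Proof.
rewrite nsq_pair_factor -[leRHS]mul1r; apply: nsq_le => //.
apply: filterS (mulop_indic mcarrier F) => x /= ->.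
by rewrite sqmodM sqmod_real ler_wpM2r ?sqmod_ge0// sqr_indic_le1.
Qed.

(** The inclusion from left to right rests on the domains: if both w_i (F o phi_i)
    are square integrable then so is m F, as |m F|^2 integrates to the sum of
    the squared norms. *)
Lemma column_polar : T = op_comp (graph u) M.
Proof.
have wc1 := wcomp_polar mphi1 mw1 hh1 mm m0 density1_le.
have wc2 := wcomp_polar mphi2 mw2 hh2 mm m0 density2_le.
apply/seteqP; split=> [[F [G1 G2]]|[F G] [F' /= mF]]; last first.
  rewrite graphE => ->; split.
  - exact/(wc1 _ _ _ mF).
  - exact/(wc2 _ _ _ mF).
move=> [/= T1 T2].
have mF : M (F, mulL2 m F).
  apply: mulL2P => //.
  rewrite -integral_densityD//.
  have wfin phi w h G : measurable_fun setT phi -> measurable_funC w ->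
      is_RN_density mu phi w h -> wcomp mu phi w (F, G) ->
      (\int[mu]_x ((sqmod (L2repr F x))%:E * h x) < +oo)%E.
    move=> mphi mw hh wFG; rewrite -(integral_wcomp mphi mw hh)//.
    rewrite -(nsq_integral_ae _ wFG) ?ltry//.
    by apply: measurable_funCM => //; exact: measurable_funC_comp.
  by rewrite lte_add_pinfty// ?(wfin _ _ _ _ mphi1 mw1 hh1 T1)//
    ?(wfin _ _ _ _ mphi2 mw2 hh2 T2).
exists (mulL2 m F) => //=; rewrite graphE /u.
by rewrite ((wc1 _ _ _ mF).1 T1) ((wc2 _ _ _ mF).1 T2).
Qed.

Lemma absop_column : absop T = M.
Proof.
have MT : is_absop T M.
  exact: (is_absop_polar (mulop_selfadjoint mu mm m0) (mulop_positive mm m0)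
    pair_factor_lin nsq_pair_factor_ran column_polar).
have [sP pP PP] : is_absop T (absop T) by apply: (@xgetI _ set0 _ M).
apply: (sqrt_mulop_unique mm m0 sP pP).
by rewrite PP; have [] := MT.
Qed.

Lemma column_ker F : T (F, 0) <-> M (F, 0).
Proof.
have u0 : u 0 = 0 by apply/nsq_eq0/eqP; rewrite eq_le nsq_ge0 andbT
  (le_trans (nsq_pair_factor_le 0))// /nsq inner0l.
rewrite column_polar; split=> [[G /= mFG]|mF]; last by exists 0.
rewrite graphE => /esym uG; suff <- : G = 0 by [].
by apply: nsq_eq0; rewrite -(nsq_pair_factor_ran mFG) uG /nsq inner0l.
Qed.

Lemma mulL2_carrier_eq0 F : mulL2 \1_carrier F = 0 <-> M (F, 0).
Proof.
have cF := mulop_indic mcarrier F; split=> [F0|mF0].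
  rewrite F0 in cF; apply: filterS2 cF (L2repr0 mu) => x /= c0 z0; rewrite z0 in c0 *.
  have [mx|/eqP mx] := eqVneq (m x) 0; first by rewrite mx mul0r.
  by move: c0; rewrite indic_in// mul1r => <-; rewrite mulr0.
apply: L2_ext; apply: filterS3 cF mF0 (L2repr0 mu) => x /= -> e z0; rewrite z0 in e *.
have [mx|/eqP mx] := eqVneq (m x) 0.
  by rewrite indic_notin ?mul0r//; apply.
move: e => /esym/eqP; rewrite mulf_eq0 => /orP[|/eqP->]; last by rewrite mulr0.
by move=> /eqP[].
Qed.

Lemma off_carrier_ker F : M (F - mulL2 \1_carrier F, 0).
Proof.
have cF := mulop_indic mcarrier F.
apply/mulL2_carrier_eq0; apply: (mulop_single_valued (mulop_indic mcarrier _)).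
have := mulop_lin (-1) (supported_indic mcarrier F) cF.
by rewrite !scaleN1r addNr [- mulL2 _ _ + _]addrC.
Qed.

Lemma pair_factor_polar_part : is_polar_part T u.
Proof.
have ker F : u F = 0 <-> T (F, 0).
  rewrite column_ker -mulL2_carrier_eq0; split=> e; apply: nsq_eq0.
    by rewrite -nsq_pair_factor e /nsq inner0l.
  by rewrite nsq_pair_factor e /nsq inner0l.
split=> //; last by rewrite absop_column column_polar.
split; first exact: pair_factor_lin.
  by exists 1 => F; rewrite mul1r !hnormE ler_wsqrtr// nsq_pair_factor_le.
move=> F oF; rewrite !hnormE; congr Num.sqrt; rewrite nsq_pair_factor.
set c := mulL2 \1_carrier F; have cF : mulop \1_carrier (F, c) := mulop_indic mcarrier F.
have sc : supported carrier c := supported_indic mcarrier F.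
have : inner F (F - c) = 0.
  by apply: oF; apply/ker/column_ker; exact: off_carrier_ker.
rewrite innerBr -(mulop_sym cF sc) => /eqP; rewrite subr_eq0 => /eqP e.
by rewrite /nsq e.
Qed.

(** A function G living on a slice splits as m (G / m) + (G - G 1_(m <> 0)): the
    first summand is in the range of |T| since G / m is square integrable, the
    second one is in the kernel of T. *)
Lemma polar_part_column : polar_part T = u.
Proof.
have pu := pair_factor_polar_part.
have pp : is_polar_part T (polar_part T) by apply: (@xgetI _ (fun=> 0) _ u).
apply: (polar_part_unique pp pu).
  by rewrite absop_column; exact: mulop_single_valued.
move=> F e e0; have [n small] := slice_dense mm m0 F e0.
set G := mulL2 \1_(slice m n) F in small.
have mS := measurable_slice mm n.
have sG : supported (slice m n) G := supported_indic mS F.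
have mi := measurable_inv_modulus mm m0.
have bi x : slice m n x -> (m x)^-1 ^+ 2 <= n.+1%:R ^+ 2.
  case=> [/= ->|]; first by rewrite invr0 expr0n sqr_ge0.
  rewrite /= in_itv /= => /andP[h _].
  have mx : 0 < m x by apply: lt_le_trans h; rewrite invr_gt0 ltr0n.
  rewrite ler_pXn2r// ?nnegrE ?invr_ge0 ?m0//.
  by rewrite invf_ple// posrE ltr0n.
set K := mulL2 (restr (fun x => (m x)^-1) (slice m n)) G.
have mK : mulop (fun x => (m x)^-1) (G, K) := mulop_supported mi mS bi sG.
set c := mulL2 \1_carrier G.
have cG : mulop \1_carrier (G, c) := mulop_indic mcarrier G.
exists K, c, (G - c); split.
- rewrite absop_column; apply: filterS2 mK cG => x /= -> ->.
  have [mx|/eqP mx] := eqVneq (m x) 0.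
    by rewrite mx indic_notin ?mul0r//; apply.
  rewrite indic_in// mul1r mulrA -(rmorphM (real_complex R)) divff ?rmorph1 ?mul1r//.
  exact/eqP.
- by apply/column_ker; exact: off_carrier_ker.
- by have -> : c + (G - c) = G by rewrite addrC subrK.
Qed.

Lemma ae_density_modulus phi w h : measurable_fun setT phi ->
  measurable_funC w -> is_RN_density mu phi w h ->
  {ae weighted_measure mu w, forall x,
    (h1 x + h2 x = h1 (phi x) + h2 (phi x))%E} <->
  {ae mu, forall x, w x <> 0 -> m (phi x) = m x}.
Proof.
move=> mphi mw hh; rewrite ae_weighted//.
have mphiE := ae_comp mphi mw hh sqr_modulus.
split; apply: filterS3 sqr_modulus mphiE => x -> + + wx => /(_ wx) -> /(_ wx).
  move=> [] /eqP; rewrite eqrXn2// ?m0// => /eqP->.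
  by [].
by move=> ->.
Qed.

End WeightedCompositionPair.

Theorem theorem30 (d : measure_display) (X : measurableType d) (R : realType)
    (mu : {sigma_finite_measure set X -> \bar R})
    (phi1 phi2 : X -> X) (w1 w2 : X -> R[i]) (h1 h2 : X -> \bar R) (l : R)
    (mphi1 : measurable_fun setT phi1) (mphi2 : measurable_fun setT phi2)
    (mw1 : measurable_funC w1) (mw2 : measurable_funC w2)
    (ac1 : pushforward (weighted_measure mu w1) phi1 `<< mu)
    (ac2 : pushforward (weighted_measure mu w2) phi2 `<< mu)
    (hh1 : is_RN_density mu phi1 w1 h1) (hh2 : is_RN_density mu phi2 w2 h2)
    (dd1 : densely_defined (wcomp mu phi1 w1))
    (dd2 : densely_defined (wcomp mu phi2 w2))
    (l0 : 0 < l) (l1 : l < 1) :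
  spherical_mean l (wcomp mu phi1 w1) (wcomp mu phi2 w2) =
    column (wcomp mu phi1 w1) (wcomp mu phi2 w2)
  <->
  {ae weighted_measure mu w1, forall x : X,
    (h1 x + h2 x = h1 (phi1 x) + h2 (phi1 x))%E} /\
  {ae weighted_measure mu w2, forall x : X,
    (h1 x + h2 x = h1 (phi2 x) + h2 (phi2 x))%E}.
Proof.
have hfin : {ae mu, forall x, h1 x \is a fin_num /\ h2 x \is a fin_num}.
  by apply: filterS2 (RN_density_finite mphi1 mw1 hh1 dd1)
    (RN_density_finite mphi2 mw2 hh2 dd2).
have absE := absop_column mphi1 mphi2 mw1 mw2 hh1 hh2 hfin.
have polE := polar_part_column mphi1 mphi2 mw1 mw2 hh1 hh2 hfin.
rewrite (ae_density_modulus hh1 hh2 hfin mphi1 mw1 hh1).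
rewrite (ae_density_modulus hh1 hh2 hfin mphi2 mw2 hh2).
have mm := measurable_modulus hh1 hh2.
have m0 := @modulus_ge0 _ X R h1 h2.
rewrite -(polar_factor_commutesP mphi1 mw1 hh1 mm m0 (density1_le hh1 hh2 hfin)).
rewrite -(polar_factor_commutesP mphi2 mw2 hh2 mm m0 (density2_le hh1 hh2 hfin)).
rewrite (spherical_mean_fixed l1); last 2 first.
- by rewrite absE; exact: mulop_single_valued.
- by rewrite absE polE; exact: column_polar.
rewrite absE polE; split=> [E|[E1 E2] F G mFG].
  by split=> F G /E [].
by split; [exact: E1|exact: E2].
Qed.
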